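(* Let $L>0$ and $a,b,c>0$, $p\in L^1[0,L]$, and consider the problem $$w''''(x)-\Big(a+b\int_0^L w(t)dt\Big)w''(x)+c\int_0^L w(t)dt=p(x)\ \text{a.e. in }(0,L),\quad w(0)=w(L)=w''(0)=w''(L)=0. \tag{P}$$ Let $M,N>0$ be constants with $N\le \frac{4M}{L^3}\sigma(\sqrt M L)$. Suppose (P) has a lower solution $\alpha$ and an upper solution $\beta$ such that $$0\le \alpha(x)\le\beta(x),\qquad 0\ge \alpha''(x)\ge\beta''(x)\quad\text{for all }x\in[0,L],$$ and $$a+b\int_0^L\beta(x)dx\le M,\qquad c-b\min_{x\in[0,L]}\beta''(x)\le N.$$ Then (P) has at least one solution in $[\alpha,\beta]:=\{u\in C^2[0,L]:\ \alpha\le u\le \beta,\ \alpha''\ge u''\ge \beta''\}$. Moreover, the sequences $(\alpha_n)$ and $(\beta_n)$ generated by the iteration below with $y_0=\alpha_0:=\alpha$ and $y_0=\beta_0:=\beta$ respectively satisfy, for all $n\ge1$, $$\alpha=\alpha_0\le\alpha_1\le\cdots\le\alpha_n\le\beta_n\le\cdots\le\beta_1\le\beta_0=\beta,$$ $$\alpha''=\alpha_0''\ge\alpha_1''\ge\cdots\ge\alpha_n''\ge\beta_n''\ge\cdots\ge\beta_1''\ge\beta_0''=\beta'',$$ and $\alpha_n$, $\beta_n$ converge uniformly on $[0,L]$ to the minimal solution $\underline y$ and the maximal solution $\overline y$ of (P) in $[\alpha,\beta]$, respectively (i.e., every solution $y$ of (P) in $[\alpha,\beta]$ satisfies $\underline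 y\le y\le\overline y$ and $\underline y''\ge y''\ge \overline y''$).
   Context: $\sigma(t):=\dfrac{3t^3}{6t\cosh t+6t-12\sinh t-t^3}$ for $t>0$. A solution of (P) is $w\in W^{4,1}[0,L]$ satisfying (P). A lower solution of (P) is $\alpha\in W^{4,1}[0,L]$ with $\alpha''''-(a+b\int_0^L\alpha)\alpha''+c\int_0^L\alpha\le p$ a.e. in $(0,L)$ and $\alpha(0)=\alpha(L)=\alpha''(0)=\alpha''(L)=0$; an upper solution is defined the same way with the inequality reversed. The iteration: given $y_{n-1}$, $y_n\in W^{4,1}[0,L]$ is the unique solution (which exists for any $M,N>0$) of $$y_n''''-My_n''+N\int_0^L y_n(t)dt=p(x)+\Big(a+b\int_0^L y_{n-1}(t)dt\Big)y_{n-1}''-c\int_0^L y_{n-1}(t)dt-My_{n-1}''+N\int_0^L y_{n-1}(t)dt,$$ $y_n(0)=y_n(L)=y_n''(0)=y_n''(L)=0$, $n=1,2,\dots$. *)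

(* Defs.v *)
From HB Require Import structures.
From mathcomp Require Import all_boot all_order all_algebra.
From mathcomp Require Import all_classical all_reals all_analysis.
Set Implicit Arguments. Unset Strict Implicit. Unset Printing Implicit Defensive.
Import Order.TTheory GRing.Theory Num.Theory.
Import numFieldNormedType.Exports.
Local Open Scope classical_set_scope.
Local Open Scope ring_scope.

Section defs.
Context {R : realType}.
Local Notation mu := (@lebesgue_measure R).

Definition coshR (t : R) : R := (expR t + expR (- t)) / 2.
Definition sinhR (t : R) : R := (expR t - expR (- t)) / 2.

Definition sigma (t : R) : R :=
  3 * t ^+ 3 / (6 * t * coshR t + 6 * t - 12 * sinhR t - t ^+ 3).

Definition int0 (x : R) (f : R -> R) : R := \int[mu]_(t in `[0, x]) f t.

(* w ∈ W^{4,1}[0,L], with w1, w2, w3, w4 its derivatives of order 1..4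
   (w4 the a.e. fourth derivative): w, w', w'' are C^1 and w''' is absolutely
   continuous on [0,L] with w'''' = w4 ∈ L^1[0,L], i.e. each is the integral of
   the next one on [0,L]. *)
Definition W41 (L : R) (w w1 w2 w3 w4 : R -> R) : Prop :=
  mu.-integrable `[0, L] (EFin \o w4) /\
  forall x, x \in `[0, L] ->
    [/\ w x = w 0 + int0 x w1,
        w1 x = w1 0 + int0 x w2,
        w2 x = w2 0 + int0 x w3 &
        w3 x = w3 0 + int0 x w4].

Definition Pop (L a b c : R) (w w2 w4 : R -> R) (x : R) : R :=
  w4 x - (a + b * int0 L w) * w2 x + c * int0 L w.

Definition ae0L (L : R) (P : R -> Prop) : Prop :=
  mu.-negligible [set x | (x \in `]0, L[) /\ ~ P x].

Definition BC (L : R) (w w2 : R -> R) : Prop :=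
  w 0 = 0 /\ w L = 0 /\ w2 0 = 0 /\ w2 L = 0.

Definition is_solP (L a b c : R) (p : R -> R) (w w1 w2 w3 w4 : R -> R) : Prop :=
  [/\ W41 L w w1 w2 w3 w4,
      ae0L L (fun x => Pop L a b c w w2 w4 x = p x)
    & BC L w w2].

Definition is_lowerP (L a b c : R) (p : R -> R) (w w1 w2 w3 w4 : R -> R) : Prop :=
  [/\ W41 L w w1 w2 w3 w4,
      ae0L L (fun x => Pop L a b c w w2 w4 x <= p x)
    & BC L w w2].

Definition is_upperP (L a b c : R) (p : R -> R) (w w1 w2 w3 w4 : R -> R) : Prop :=
  [/\ W41 L w w1 w2 w3 w4,
      ae0L L (fun x => p x <= Pop L a b c w w2 w4 x)
    & BC L w w2].

(* y (with derivatives y1..y4) is the iterate obtained from z (with second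
   derivative z2) in the monotone iteration with constants M, N. *)
Definition is_iterP (L a b c M N : R) (p : R -> R) (z z2 : R -> R)
    (y y1 y2 y3 y4 : R -> R) : Prop :=
  [/\ W41 L y y1 y2 y3 y4,
      ae0L L (fun x =>
        y4 x - M * y2 x + N * int0 L y =
        p x + (a + b * int0 L z) * z2 x - c * int0 L z - M * z2 x + N * int0 L z)
    & BC L y y2].

Definition in_ab (L : R) (al al2 be be2 u u2 : R -> R) : Prop :=
  forall x, x \in `[0, L] ->
    [/\ al x <= u x, u x <= be x, u2 x <= al2 x & be2 x <= u2 x].

Definition unif_cvg (L : R) (f : nat -> R -> R) (g : R -> R) : Prop :=
  forall e : R, 0 < e -> exists n0 : nat, forall n, (n0 <= n)%N ->
    forall x, x \in `[0, L] -> `|f n x - g x| < e.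

End defs.

(* Main.v *)
Require Import Defs.
From HB Require Import structures.
From mathcomp Require Import all_boot all_order all_algebra.
From mathcomp Require Import all_classical all_reals all_analysis.
From mathcomp Require Import measurable_realfun ring lra.
Import Order.TTheory GRing.Theory Num.Theory.
Import numFieldNormedType.Exports.
Local Open Scope classical_set_scope.
Local Open Scope ring_scope.

(* The operator [y'''' - M y'' + N int y] with hinged boundary values obeys a
   maximum principle: if it is nonnegative then [y >= 0] and [y'' <= 0]. Indeed
   [v := - y''] solves [- v'' + m^2 v = h - N k] with [m^2 = M], [h >= 0] and
   [k = int y = int phi v], [phi s = s (L - s) / 2]. Pairing [h] with the Green
   kernel of [- v'' + m^2 v] gives [v], and pairing it with the solution of
   [- psi'' + m^2 psi = phi] gives [k]. Both [1] and [phi] being positive, the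
   worst case of the comparison of these two kernels is at a corner of the
   square, and there it reads exactly [N <= 4 M / L^3 * sigma (m L)].

   Under the bounds on [beta], the iteration map preserves the order
   ([y <= z] and [y'' >= z'']), so the iterates are monotone. Their second
   derivatives and integrals converge, hence so do, by dominated convergence,
   the fourth derivatives; integrating back, the Dirichlet conditions fix the
   constants of integration and give uniform limits solving the problem. *)

(** * Integrals from 0 and absolutely continuous functions on [[0, L]] *)

Section integral_from_zero.
Context {R : realType}.
Local Notation mu := (@lebesgue_measure R).
Implicit Types (L x y : R) (f g F G : R -> R).

(** Absolute continuity of [F] with a.e. derivative [f], encoded as one link of the chain in [W41].
    All later calculus is done on such pairs, without pointwise derivatives. *)
Definition ac_on L F f :=
  mu.-integrable `[0, L] (EFin \o f) /\
  forall x, x \in `[0, L] -> F x = F 0 + int0 x f.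

Lemma mem_itv0 L x : (x \in `[0, L]) = (0 <= x <= L).
Proof. by rewrite in_itv. Qed.

Lemma integrable_sub_itv0 L x f : x <= L ->
  mu.-integrable `[0, L] (EFin \o f) -> mu.-integrable `[0, x] (EFin \o f).
Proof.
move=> xL; apply: integrableS => //.
by move=> z /=; rewrite !in_itv/= => /andP[-> zx]/=; exact: le_trans xL.
Qed.

Lemma int0_at0 f : int0 0 f = 0.
Proof. by rewrite /int0 set_itv1 Rintegral_set1. Qed.

Lemma eq_int0 x f g : {in `[0, x], f =1 g} -> int0 x f = int0 x g.
Proof. by move=> fg; apply: eq_Rintegral => z; rewrite inE => /fg. Qed.

Lemma int0D L x f g : x <= L ->
  mu.-integrable `[0, L] (EFin \o f) -> mu.-integrable `[0, L] (EFin \o g) ->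
  int0 x (fun z => f z + g z) = int0 x f + int0 x g.
Proof. by move=> xL /(integrable_sub_itv0 _ x _ xL) fi
  /(integrable_sub_itv0 _ x _ xL) gi; exact: RintegralD. Qed.

Lemma int0Z L x f r : x <= L -> mu.-integrable `[0, L] (EFin \o f) ->
  int0 x (fun z => r * f z) = r * int0 x f.
Proof. by move=> xL /(integrable_sub_itv0 _ x _ xL) fi; exact: RintegralZl. Qed.

Lemma integrableD_fun (D : set R) f g : measurable D ->
  mu.-integrable D (EFin \o f) -> mu.-integrable D (EFin \o g) ->
  mu.-integrable D (EFin \o (fun z => f z + g z)).
Proof.
move=> mD fi gi; rewrite (_ : EFin \o _ = (EFin \o f) \+ (EFin \o g))%E//.
exact: integrableD.
Qed.

Lemma integrableZ_fun (D : set R) f r : measurable D ->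
  mu.-integrable D (EFin \o f) ->
  mu.-integrable D (EFin \o (fun z => r * f z)).
Proof.
move=> mD fi; rewrite (_ : EFin \o _ = fun z => r%:E * (EFin \o f) z)%E//.
exact: integrableZl.
Qed.

Lemma int0_cst x r : 0 <= x -> int0 x (fun=> r) = r * x.
Proof.
move=> x0; rewrite /int0 Rintegral_cst//= lebesgue_measure_itv/= lte_fin.
have [?|x_le0] := ltP 0 x; first by rewrite sube0.
by rewrite (le_anti (introT andP (conj x_le0 x0))).
Qed.

Lemma integrable_cst_itv0 L r : mu.-integrable `[0, L] (EFin \o (fun=> r)).
Proof.
apply: continuous_compact_integrable; first exact: segment_compact.
by apply: continuous_subspaceT => ?; exact: cvg_cst.
Qed.

Lemma eq_integrable_itv0 L f g : {in `[0, L], f =1 g} ->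
  mu.-integrable `[0, L] (EFin \o f) -> mu.-integrable `[0, L] (EFin \o g).
Proof.
move=> fg; apply: eq_integrable => //= z; rewrite inE /= => /fg.
by move=> ->.
Qed.

Lemma ae0L_itv L (P : R -> Prop) : ae0L L P ->
  {ae mu, forall x, `[0, L]%classic x -> P x}.
Proof.
move=> H; have n1 (r : R) : mu.-negligible [set r].
  by apply/negligibleP => //; exact: lebesgue_measure_set1.
apply: negligibleS (negligibleU (negligibleU H (n1 0)) (n1 L)).
move=> x /= /not_implyP[]; rewrite /= in_itv/= => /andP[x0 xL] nP.
have [->|xn0] := eqVneq x 0; first by left; right.
have [->|xnL] := eqVneq x L; first by right.
by left; left; split => //; rewrite in_itv/= !lt_neqAle x0 xL xnL eq_sym xn0.
Qed.

Lemma ae_eq_int0 L x f g : x <= L ->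
  mu.-integrable `[0, L] (EFin \o f) -> mu.-integrable `[0, L] (EFin \o g) ->
  ae0L L (fun z => f z = g z) -> int0 x f = int0 x g.
Proof.
move=> xL /(integrable_sub_itv0 _ x _ xL) fi
  /(integrable_sub_itv0 _ x _ xL) gi /ae0L_itv fg.
congr fine; apply: ae_eq_integral => //;
  [exact: measurable_int fi|exact: measurable_int gi|].
apply: negligibleS fg => z /= H fgz; apply: H; rewrite /= in_itv/= => /andP[z0 zx].
by rewrite fgz// in_itv/= z0 (le_trans zx).
Qed.

Lemma int0_homo L f x y : mu.-integrable `[0, L] (EFin \o f) ->
  ae0L L (fun z => 0 <= f z) -> 0 <= x -> x <= y -> y <= L ->
  int0 x f <= int0 y f.
Proof.
move=> fi f0 x0 xy yL.
(* [f] is nonnegative only almost everywhere; it is exchanged for its absolute value, which is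
   nonnegative everywhere and has the same integrals. *)
have fn : ae0L L (fun z => f z = `|f z|).
  by apply: negligibleS f0 => z /= [zL] H; split=> // f0; apply: H; rewrite ger0_norm.
have ni : mu.-integrable `[0, L] (EFin \o (fun z => `|f z|)).
  exact: (integrable_norm fi).
rewrite (ae_eq_int0 _ _ _ _ yL fi ni fn) (ae_eq_int0 _ _ _ _ (le_trans xy yL) fi ni fn).
rewrite -subr_ge0 /int0 Rintegral_itvB ?bnd_simp//.
  by apply: Rintegral_ge0.
exact: (integrable_sub_itv0 _ _ _ yL ni).
Qed.

Lemma le_int0 L f g x : mu.-integrable `[0, L] (EFin \o f) ->
  mu.-integrable `[0, L] (EFin \o g) ->
  {in `[0, L], forall z, f z <= g z} -> x <= L ->
  int0 x f <= int0 x g.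
Proof.
move=> fi gi fg xL; apply: le_Rintegral => //.
- exact: integrable_sub_itv0 xL fi.
- exact: integrable_sub_itv0 xL gi.
- move=> z /=; rewrite in_itv/= => /andP[z0 zx]; apply: fg.
  by rewrite in_itv/= z0 (le_trans zx).
Qed.

Lemma ac_on_continuous L F f : 0 <= L -> ac_on L F f ->
  {within `[0, L], continuous F}.
Proof.
move=> L0 [fi FE].
have H : {within `[0, L], continuous (fun x => F 0 + int0 x f)}.
  have := @parameterized_integral_continuous R 0 L f L0 fi.
  move=> + x => /(_ x) H; apply: cvgD; [exact: cvg_cst|exact: H].
apply: subspace_eq_continuous H.
by move=> x; rewrite inE => /FE/esym.
Qed.

Lemma within_continuous_integrable L F : {within `[0, L], continuous F} ->
  mu.-integrable `[0, L] (EFin \o F).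
Proof. by move=> cF; apply: continuous_compact_integrable => //;
  exact: segment_compact. Qed.

Lemma ac_on_integrable L F f : 0 <= L -> ac_on L F f ->
  mu.-integrable `[0, L] (EFin \o F).
Proof. by move=> L0 /(ac_on_continuous _ _ _ L0);
  exact: within_continuous_integrable. Qed.

Lemma ac_on_bounded L F f : 0 <= L -> ac_on L F f ->
  exists B, {in `[0, L], forall x, `|F x| <= B}.
Proof.
move=> L0 /(ac_on_continuous _ _ _ L0) cF.
have [c _ cmax] := @EVT_max R (fun x => `|F x|) 0 L L0
  (fun x => continuous_comp (cF x) (@norm_continuous _ _ _)).
by exists (`|F c|) => x /cmax.
Qed.

Lemma ac_onD {L F f G g} : ac_on L F f -> ac_on L G g ->
  ac_on L (fun x => F x + G x) (fun x => f x + g x).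
Proof.
move=> [fi FE] [gi GE]; split; first exact: integrableD_fun.
move=> x xL; rewrite (FE _ xL) (GE _ xL) (int0D L)//; first ring.
by case/andP: xL.
Qed.

Lemma ac_onZ {L} r {F f} : ac_on L F f ->
  ac_on L (fun x => r * F x) (fun x => r * f x).
Proof.
move=> [fi FE]; split; first exact: integrableZ_fun.
move=> x xL; rewrite (FE _ xL) (int0Z L)//; first ring.
by case/andP: xL.
Qed.

Lemma eq_ac_on L F f G g : {in `[0, L], F =1 G} -> {in `[0, L], f =1 g} ->
  ac_on L F f -> ac_on L G g.
Proof.
move=> FG fg [fi FE]; split; first exact: eq_integrable_itv0 fi.
move=> x /[dup] xL; rewrite in_itv/= => /andP[x0 xL'].
have z0L : 0 \in `[0, L] by rewrite in_itv/= lexx (le_trans x0).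
rewrite -(FG _ xL) -(FG _ z0L) FE//; congr (_ + _).
apply: eq_int0 => z; rewrite in_itv/= => /andP[z0 zx].
by apply: fg; rewrite in_itv/= z0 (le_trans zx).
Qed.

Lemma ac_on_homo L F f x y : ac_on L F f -> ae0L L (fun z => 0 <= f z) ->
  0 <= x -> x <= y -> y <= L -> F x <= F y.
Proof.
move=> [fi FE] f0 x0 xy yL.
rewrite (FE x) ?(FE y) ?lerD2l ?in_itv/= ?x0 ?yL ?(le_trans xy yL) ?(le_trans x0 xy)//.
exact: int0_homo f0 _ _ _.
Qed.

Lemma ac_on_int0 L f : 0 <= L -> mu.-integrable `[0, L] (EFin \o f) ->
  ac_on L (int0^~ f) f.
Proof. by move=> L0 fi; split=> // x _; rewrite int0_at0 add0r. Qed.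

Lemma is_derive_ac_on L F f : (forall x : R, is_derive x 1 F (f x)) ->
  continuous f -> ac_on L F f.
Proof.
move=> dF cf; split.
  by apply: within_continuous_integrable; exact: continuous_subspaceT.
move=> x; rewrite in_itv/= => /andP[]; rewrite le_eqVlt => /predU1P[<-|x0] xL.
  by rewrite int0_at0 addr0.
have cF : continuous F.
  by move=> z; apply/differentiable_continuous/derivable1_diffP; case: (dF z).
rewrite /int0 /Rintegral (@continuous_FTC2 _ f F)//=; first ring.
- exact: continuous_subspaceT.
- split.
  + by move=> z _; case: (dF z).
  + exact/cvg_at_right_filter/cF.
  + exact/cvg_at_left_filter/cF.
- by move=> z _; rewrite derive1E; case: (dF z).
Qed.

End integral_from_zero.

(** * Product rule for absolutely continuous functions, by Fubini *)

Section product_rule.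
Context {R : realType}.
Local Notation mu := (@lebesgue_measure R).
Implicit Types (L x y : R) (f g F G : R -> R).

Lemma integrable_mul_bounded L f G B : mu.-integrable `[0, L] (EFin \o f) ->
  mu.-integrable `[0, L] (EFin \o G) -> {in `[0, L], forall x, `|G x| <= B} ->
  mu.-integrable `[0, L] (EFin \o (fun x => f x * G x)).
Proof.
move=> fi Gi GB.
apply: (le_integrable _ _ _ (integrableZ_fun _ _ B _ (integrable_norm fi))) => //.
  apply/measurable_EFinP/measurable_funM; apply/measurable_EFinP.
  - exact: measurable_int fi.
  - exact: measurable_int Gi.
move=> x /= /GB GBx; rewrite lee_fin normrM mulrC normrM normr_id.
by rewrite ler_wpM2r// (le_trans GBx)// ler_norm.
Qed.

Lemma integrable_itv0_restrict x f : mu.-integrable `[0, x] (EFin \o f) ->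
  mu.-integrable setT (EFin \o (f \_ `[0, x])).
Proof.
by move=> fi; rewrite -restrict_EFin; apply/integrable_restrict => //; rewrite setTI.
Qed.

(** Both sides integrate [f s * g r] over the triangle [0 <= r <= s <= x], in the two possible
    orders. This is what replaces integration by parts when derivatives exist only almost
    everywhere. *)
Lemma int0_triangle x f g : mu.-integrable `[0, x] (EFin \o f) ->
  mu.-integrable `[0, x] (EFin \o g) ->
  int0 x (fun s => f s * int0 s g) = int0 x (fun r => g r * (int0 x f - int0 r f)).
Proof.
move=> fi gi.
pose a : R -> R := f \_ `[0, x]; pose b : R -> R := g \_ `[0, x].
pose k (z : R * R) : R := a z.1 * b z.2 * (z.2 <= z.1)%R%:R.
have ai : mu.-integrable setT (EFin \o a) by exact: integrable_itv0_restrict.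
have bi : mu.-integrable setT (EFin \o b) by exact: integrable_itv0_restrict.
have ma : measurable_fun setT a by apply/measurable_EFinP; exact: measurable_int ai.
have mb : measurable_fun setT b by apply/measurable_EFinP; exact: measurable_int bi.
have mk : measurable_fun setT (EFin \o k).
  apply/measurable_EFinP; apply: measurable_funM; first apply: measurable_funM.
  - exact: measurableT_comp.
  - exact: measurableT_comp.
  - have -> : (fun z : R * R => (z.2 <= z.1)%R%:R : R) =
              (fun z => if (z.2 <= z.1)%R then 1 else 0).
      by apply/funext => z; case: (_ <= _).
    by apply: measurable_fun_ifT => //; exact: measurable_fun_ler.
(* The indicator of the triangle only decreases the absolute value, so Tonelli applies with the
   majorant [|a s| * |b r|], whose iterated integral is a product of two finite integrals. *)
have ki : (mu \x mu)%E.-integrable setT (EFin \o k).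
  apply/integrable12ltyP => //.
  have bn : (\int[mu]_y `|(b y)%:E| = (\int[mu]_y `|b y|)%R%:E)%E.
    rewrite /Rintegral fineK//.
    exact: (integrable_fin_num _ (integrable_norm bi)).
  apply: (@le_lt_trans _ _ (\int[mu]_s (`|a s| * (\int[mu]_y `|b y|)%R)%:E)%E);
    last first.
    have := integrableZ_fun _ _ (\int[mu]_y `|b y|) measurableT (integrable_norm ai).
    move=> /integrableP[_]; apply: le_lt_trans.
    apply: ge0_le_integral => //.
    + by move=> s _; rewrite lee_fin mulr_ge0// Rintegral_ge0.
    + apply/measurable_EFinP; apply: measurable_funM => //.
      exact: measurableT_comp.
    + apply/measurable_EFinP; apply: measurableT_comp => //.
      by apply: measurable_funM => //; exact: measurableT_comp.
    + by move=> s _; rewrite lee_fin mulrC ler_norm.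
  apply: ge0_le_integral => //.
  - by move=> s _; apply: integral_ge0.
  - have mak : measurable_fun setT (abse \o (EFin \o k)) by exact: measurableT_comp.
    apply: (@measurable_fun_fubini_tonelli_F _ _ _ _ R mu _ mak) => z.
    exact: abse_ge0.
  - by apply/measurable_EFinP; apply: measurable_funM => //; exact: measurableT_comp.
  move=> s _; rewrite EFinM -bn -ge0_integralZl//; first last.
    by apply: measurableT_comp => //; exact/measurable_EFinP.
  apply: ge0_le_integral => //.
  - apply: measurableT_comp => //; apply/measurable_EFinP.
    by move/measurable_EFinP : mk; exact: measurable_fun_pair2.
  - apply: measurable_funeM; apply: measurableT_comp => //.
    exact/measurable_EFinP.
  - move=> y _; rewrite -EFinM lee_fin /k /= !normrM.
    by rewrite ler_piMr ?mulr_ge0//; case: (y <= s)%R; rewrite ?normr1 ?normr0.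
have inner1 s : (\int[mu]_r (EFin \o k) (s, r))%E =
    (((fun s => f s * int0 s g) \_ `[0, x]) s)%:E.
  rewrite /= patchE; case: ifPn => [|sx].
    rewrite inE/= => /[dup] sx; rewrite in_itv/= => /andP[s0 sx'].
    have gis := integrable_sub_itv0 _ _ _ sx' gi.
    rewrite /int0 Rintegral_mkcond -RintegralZl//; last first.
      exact: integrable_itv0_restrict.
    rewrite /Rintegral fineK; last first.
      apply: integrable_fin_num => //.
      exact: (integrableZ_fun _ _ (f s) measurableT (integrable_itv0_restrict _ _ gis)).
    apply: eq_integral => r _; rewrite /k /a /b /= !patchE !mem_setE sx -mulrA.
    congr ((_ * _)%:E); rewrite !in_itv/=.
    case: (leP r s) => rs; last by rewrite andbF mulr0.
    by rewrite (le_trans rs sx') andbT mulr1.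
  rewrite (eq_integral (fun=> 0%E)) ?integral0// => r _.
  by rewrite /k /a /= patchE (negbTE sx) !mul0r.
have inner2 r : (\int[mu]_s (EFin \o k) (s, r))%E =
    (((fun r => g r * (int0 x f - int0 r f)) \_ `[0, x]) r)%:E.
  rewrite /= patchE; case: ifPn => [|rx].
    rewrite inE/= => /[dup] rx; rewrite in_itv/= => /andP[r0 rx'].
    rewrite /int0 Rintegral_itvB ?bnd_simp//.
    have fir : mu.-integrable `[r, x] (EFin \o f).
      apply: integrableS fi => // z /=; rewrite !in_itv/= => /andP[rz ->].
      by rewrite (le_trans r0).
    rewrite Rintegral_itv_obnd_cbnd; last first.
      apply: integrableS fir => // z /=; rewrite !in_itv/= => /andP[rz ->].
      by rewrite ltW.
    have fir' : mu.-integrable setT (EFin \o (f \_ `[r, x])).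
      by rewrite -restrict_EFin; apply/integrable_restrict => //; rewrite setTI.
    rewrite Rintegral_mkcond -RintegralZl//.
    rewrite /Rintegral fineK; last first.
      apply: integrable_fin_num => //.
      exact: (integrableZ_fun _ _ (g r) measurableT fir').
    apply: eq_integral => s _; rewrite /k /a /b /= !patchE !mem_setE rx.
    rewrite (mulrC _ (g r)) -mulrA; congr ((_ * _)%:E); rewrite !in_itv/=.
    case: (leP r s) => rs; last by rewrite mulr0.
    by rewrite (le_trans r0 rs) mulr1.
  rewrite (eq_integral (fun=> 0%E)) ?integral0// => s _.
  by rewrite /k /b /= patchE (negbTE rx) mulr0 mul0r.
have := Fubini ki.
under eq_integral do rewrite inner1.
under [in X in _ = X -> _]eq_integral do rewrite inner2.
by move=> /(congr1 fine) H; rewrite /int0 Rintegral_mkcond [RHS]Rintegral_mkcond.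
Qed.

(** In [int0_triangle], the inner integrals of [f] and [g] are [F] and [G] up to their values at 0;
    after this substitution the identity is the product rule. *)
Lemma ac_onM {L F f G g} : 0 <= L -> ac_on L F f -> ac_on L G g ->
  ac_on L (fun x => F x * G x) (fun x => f x * G x + F x * g x).
Proof.
move=> L0 acF acG.
have [BF FB] := ac_on_bounded _ _ _ L0 acF.
have [BG GB] := ac_on_bounded _ _ _ L0 acG.
have Fi := ac_on_integrable _ _ _ L0 acF.
have Gi := ac_on_integrable _ _ _ L0 acG.
move: acF acG => [fi FE] [gi GE].
have fGi := integrable_mul_bounded _ _ _ _ fi Gi GB.
have Fgi : mu.-integrable `[0, L] (EFin \o (fun x => F x * g x)).
  apply: eq_integrable_itv0 (integrable_mul_bounded _ _ _ _ gi Fi FB).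
  by move=> x _; rewrite mulrC.
split; first exact: integrableD_fun.
move=> x xL; have /andP[x0 xL'] : 0 <= x <= L by rewrite -mem_itv0.
rewrite (int0D L)//.
have sub z : z \in `[0, x] -> z \in `[0, L].
  by rewrite !in_itv/= => /andP[-> zx]; rewrite (le_trans zx).
have fix_ := integrable_sub_itv0 _ _ _ xL' fi.
have gix_ := integrable_sub_itv0 _ _ _ xL' gi.
have := int0_triangle _ _ _ fix_ gix_.
rewrite (@eq_int0 _ x (fun s => f s * int0 s g) (fun s => f s * G s + (- G 0) * f s));
  last first.
  by move=> z zx; rewrite (GE _ (sub _ zx)); ring.
rewrite (@eq_int0 _ x
  (fun s => g s * _) (fun s => (int0 x f + F 0) * g s + (-1) * (F s * g s))); last first.
  by move=> z zx; rewrite (FE _ (sub _ zx)); ring.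
rewrite !(int0D L)//; [|exact: integrableZ_fun..].
rewrite !(int0Z L)// (FE _ xL) (GE _ xL) => H.
have -> : int0 x (fun z => f z * G z) = G 0 * int0 x f + ((int0 x f + F 0) * int0 x g +
   -1 * int0 x (fun z => F z * g z)) by rewrite -H; ring.
ring.
Qed.

End product_rule.

(** * Hyperbolic functions and the inequalities behind the kernel comparison *)

Section hyperbolic.
Context {R : realType}.
Implicit Types x y t : R.

Lemma sinhR0 : sinhR (0 : R) = 0.
Proof. by rewrite /sinhR oppr0 subrr mul0r. Qed.

Lemma coshR0 : coshR (0 : R) = 1.
Proof. by rewrite /coshR oppr0 expR0; field. Qed.

Lemma sinhRD x y : sinhR (x + y) = sinhR x * coshR y + coshR x * sinhR y.
Proof. by rewrite /sinhR /coshR opprD !expRD; field. Qed.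

Lemma coshRD x y : coshR (x + y) = coshR x * coshR y + sinhR x * sinhR y.
Proof. by rewrite /sinhR /coshR opprD !expRD; field. Qed.

Lemma coshR2_sinhR2 x : coshR x ^+ 2 - sinhR x ^+ 2 = 1.
Proof.
have e : expR x * expR (- x) = 1 by rewrite -expRD subrr expR0.
by rewrite -[RHS]e /sinhR /coshR; field.
Qed.

Lemma coshR_gt0 x : 0 < coshR x.
Proof. by rewrite divr_gt0// addr_gt0// expR_gt0. Qed.

Global Instance is_derive_sinhR x : is_derive x 1 sinhR (coshR x).
Proof. by apply: is_derive_eq; rewrite /coshR /GRing.scale/=; field. Qed.

Global Instance is_derive_coshR x : is_derive x 1 coshR (sinhR x).
Proof. by apply: is_derive_eq; rewrite /sinhR /GRing.scale/=; field. Qed.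

Lemma is_derive_continuous (F f : R -> R) :
  (forall x : R, is_derive x 1 F (f x)) -> continuous F.
Proof.
by move=> dF x; apply/differentiable_continuous/derivable1_diffP; case: (dF x).
Qed.

Lemma derive_gt0_pos (F f : R -> R) y : (forall x : R, is_derive x 1 F (f x)) ->
  (forall x, 0 < x -> 0 < f x) -> F 0 = 0 -> 0 < y -> 0 < F y.
Proof.
move=> dF f0 F0 y0; rewrite -F0; apply: (@gtr0_derive1_lt_cc _ F 0 y) => //.
- move=> x; rewrite in_itv/= => /andP[x0 _]; rewrite derive1E.
  by case: (dF x) => _ ->; exact: f0.
- exact/continuous_subspaceT/(is_derive_continuous _ _ dF).
- by rewrite in_itv/= lexx ltW.
- by rewrite in_itv/= lexx ltW.
Qed.

Lemma sinhR_gt0 x : 0 < x -> 0 < sinhR x.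
Proof. by apply: derive_gt0_pos => [y _|]; [exact: coshR_gt0|exact: sinhR0]. Qed.

Lemma sinhR_ge0 x : 0 <= x -> 0 <= sinhR x.
Proof. by rewrite le_eqVlt => /predU1P[<-|/sinhR_gt0/ltW//]; rewrite sinhR0. Qed.

Lemma coshR_gt1 x : 0 < x -> 1 < coshR x.
Proof.
move=> x0; rewrite -subr_gt0; apply: (derive_gt0_pos (fun z => coshR z - 1) sinhR) => //.
- by move=> z; apply: is_derive_eq; rewrite subr0.
- exact: sinhR_gt0.
- by rewrite coshR0 subrr.
Qed.

Lemma coshR_ge1 x : 0 <= x -> 1 <= coshR x.
Proof. by rewrite le_eqVlt => /predU1P[<-|/coshR_gt1/ltW//]; rewrite coshR0. Qed.

Lemma sinhR_ge_id x : 0 <= x -> x <= sinhR x.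
Proof.
rewrite le_eqVlt => /predU1P[<-|x0]; first by rewrite sinhR0.
apply: ltW; rewrite -subr_gt0.
apply: (derive_gt0_pos (fun z => sinhR z - z) (fun z => coshR z - 1)) => //.
- by move=> z z0; rewrite subr_gt0 coshR_gt1.
- by rewrite sinhR0 subrr.
Qed.

Lemma sinhR_lt_mul_coshR x : 0 < x -> sinhR x < x * coshR x.
Proof.
move=> x0; rewrite -subr_gt0.
apply: (derive_gt0_pos (fun z => z * coshR z - sinhR z) (fun z => z * sinhR z)) => //.
- move=> z; have d := is_deriveB (is_deriveM (is_derive_id z (1 : R))
    (is_derive_coshR z)) (is_derive_sinhR z).
  by apply: (is_derive_eq d); rewrite /GRing.scale/=; ring.
- by move=> z z0; rewrite mulr_gt0// sinhR_gt0.
- by rewrite sinhR0 mul0r subrr.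
Qed.

(** With [y = t / 2], [s = sinhR y] and [c = coshR y], the difference of the two sides is
    [2 s (y c - s)], positive because [tanh y < y]. *)
Lemma coshR_sub1_lt t : 0 < t -> coshR t - 1 < t / 2 * sinhR t.
Proof.
move=> t0; have y0 : 0 < t / 2 by rewrite divr_gt0.
have tE : t = t / 2 + t / 2 by field.
rewrite {1 3}tE sinhRD coshRD.
have := coshR2_sinhR2 (t / 2); have := sinhR_lt_mul_coshR _ y0.
have := sinhR_gt0 _ y0; move: (t / 2) (sinhR _) (coshR _) => y s c s0 h e.
rewrite -e -subr_gt0 (_ : _ - _ = 2 * (s * (y * c - s))); last by ring.
by rewrite !mulr_gt0// subr_gt0.
Qed.

(** Up to a positive factor, this is the gap in [chi_le] below. Writing [t = (t - x) + x] splits it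
    into a multiple of [sinhR x - x] and the previous inequality at [x]. *)
Lemma coshR_sub1_le t x : 0 <= x -> x <= t ->
  0 <= 1 - coshR x + t / 2 * sinhR x - x * (t - x) / 2.
Proof.
move=> x0 xt.
rewrite (_ : _ - _ = (t - x) / 2 * (sinhR x - x) + (x / 2 * sinhR x - (coshR x - 1)));
  last by field.
apply: addr_ge0; first by rewrite mulr_ge0 ?divr_ge0 ?subr_ge0// sinhR_ge_id.
move: x0; rewrite le_eqVlt => /predU1P[<-|x0].
  by rewrite sinhR0 coshR0 !subrr mulr0 subrr.
by rewrite subr_ge0 ltW// coshR_sub1_lt.
Qed.

End hyperbolic.

(** * Elementary primitives, and positivity for a second-order problem with a nonlocal term *)

Section maximum_principle.
Context {R : realType}.
Local Notation mu := (@lebesgue_measure R).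

Lemma ac_on_affine (L p q : R) (F f : R -> R) :
  (forall x : R, is_derive x 1 F (f x)) -> continuous f ->
  ac_on L (fun s => F (p * s + q)) (fun s => p * f (p * s + q)).
Proof.
move=> dF cf; apply: is_derive_ac_on => [x|x].
  have da : is_derive x 1 (fun s => p * s + q) p.
    have d := is_deriveD (is_deriveZ p (is_derive_id x (1 : R))) (is_derive_cst q x (1 : R)).
    by apply: (is_derive_eq d); rewrite /GRing.scale/= mulr1 addr0.
  have d := @is_derive1_comp R F (fun s => p * s + q) x _ _ (dF _) da.
  by apply: (is_derive_eq d); rewrite mulrC.
have ca : {for x, continuous (fun s : R => p * s + q)}.
  by apply: cvgD; [apply: cvgMr; exact: cvg_id|exact: cvg_cst].
apply: cvgM; first exact: cvg_cst.
by apply: (continuous_comp ca); exact: cf.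
Qed.

Lemma ac_on_id (L : R) : ac_on L id (fun=> 1).
Proof. by apply: is_derive_ac_on => x; exact: cvg_cst. Qed.

Lemma ac_on_cst (L r : R) : ac_on L (fun=> r) (fun=> 0).
Proof. by apply: is_derive_ac_on => x; exact: cvg_cst. Qed.

Lemma ac_on_antitone (L x y : R) (F f : R -> R) :
  ac_on L F f -> ae0L L (fun z => f z <= 0) ->
  0 <= x -> x <= y -> y <= L -> F y <= F x.
Proof.
move=> /(ac_onZ (-1))/ac_on_homo H f0 x0 xy yL.
have := H x y _ x0 xy yL; rewrite !mulN1r lerN2; apply.
apply: negligibleS f0 => z /= [zL] n; split => // fz; apply: n.
by rewrite mulN1r oppr_ge0.
Qed.

Lemma ae0L_imp (L : R) (P Q : R -> Prop) :
  (forall x, x \in `]0, L[ -> P x -> Q x) -> ae0L L P -> ae0L L Q.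
Proof.
by move=> PQ; apply: negligibleS => x /= [xL nQ]; split => // /(PQ _ xL).
Qed.

(** * Comparison of the Green kernel of [- v'' + m^2 v] with the kernel giving [k] *)

Section helmholtz.
Variables (L m N k : R) (v v1 v2 : R -> R).
Hypotheses (L0 : 0 < L) (m0 : 0 < m) (N0 : 0 < N).
Hypotheses (acv : ac_on L v v1) (acv1 : ac_on L v1 v2).
Hypotheses (v0 : v 0 = 0) (vL : v L = 0).
Hypothesis kE : k = int0 L (fun s => s * (L - s) / 2 * v s).
Let t := m * L.
(** The bound on [N] cleared of denominators: with [M = m ^+ 2] and [t = m * L], the quantity
    [4 M / L^3 * sigma t] is [12 m^5] over the bracket. *)
Hypothesis Nle :
  N * (6 * t * coshR t + 6 * t - 12 * sinhR t - t ^+ 3) <= 12 * m ^+ 5.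
Let h s := m ^+ 2 * v s + N * k - v2 s.
Hypothesis h0 : ae0L L (fun s => 0 <= h s).

(** Primes denote reflection [s -> L - s], not derivatives. [S] and [S'] are the homogeneous
    solutions vanishing at 0 and at [L]; the Green kernel is their product over [m * sinhR t]. *)
Let S s := sinhR (m * s).
Let C s := coshR (m * s).
Let S' s := sinhR (m * (L - s)).
Let C' s := coshR (m * (L - s)).

Let L0' : 0 <= L. Proof. exact: ltW. Qed.

Let csinh : continuous (@sinhR R).
Proof. exact: (is_derive_continuous _ _ is_derive_sinhR). Qed.

Let ccosh : continuous (@coshR R).
Proof. exact: (is_derive_continuous _ _ is_derive_coshR). Qed.

Let acS : ac_on L S (fun s => m * C s).
Proof.
apply: eq_ac_on (ac_on_affine L m 0 _ _ is_derive_sinhR ccosh).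
- by move=> s _; rewrite addr0.
- by move=> s _; rewrite addr0.
Qed.

Let acC : ac_on L C (fun s => m * S s).
Proof.
apply: eq_ac_on (ac_on_affine L m 0 _ _ is_derive_coshR csinh).
- by move=> s _; rewrite addr0.
- by move=> s _; rewrite addr0.
Qed.

Let acS' : ac_on L S' (fun s => - m * C' s).
Proof.
apply: eq_ac_on (ac_on_affine L (- m) t _ _ is_derive_sinhR ccosh).
- by move=> s _; rewrite /S' /t; congr sinhR; ring.
- by move=> s _; rewrite /C' /t; congr (_ * coshR _); ring.
Qed.

Let acC' : ac_on L C' (fun s => - m * S' s).
Proof.
apply: eq_ac_on (ac_on_affine L (- m) t _ _ is_derive_coshR csinh).
- by move=> s _; rewrite /C' /t; congr coshR; ring.
- by move=> s _; rewrite /S' /t; congr (_ * sinhR _); ring.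
Qed.

Let mn0 : m != 0. Proof. by rewrite gt_eqF. Qed.

(** [P1] and [P2] are Wronskians of [v] with [S] and [S'], corrected by a primitive of the constant
    load [N k]. Their increments are the integrals of [S * h] over [[0, x]] and of [S' * h] over
    [[x, L]], the two halves of the Green formula. *)
Let P1 s := m * C s * v s - S s * v1 s + N * k / m * C s.
Let P2 s := m * C' s * v s + S' s * v1 s + N * k / m * C' s.

Let acP1 : ac_on L P1 (fun s => S s * h s).
Proof.
apply: eq_ac_on (ac_onD (ac_onM L0' (ac_onZ m acC) acv)
  (ac_onD (ac_onZ (-1) (ac_onM L0' acS acv1))
     (ac_onZ (N * k / m) acC))) => s _.
- by rewrite /P1; ring.
- by rewrite /h; field.
Qed.

Let acP2 : ac_on L P2 (fun s => - (S' s * h s)).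
Proof.
apply: eq_ac_on (ac_onD (ac_onM L0' (ac_onZ m acC') acv)
  (ac_onD (ac_onM L0' acS' acv1)
     (ac_onZ (N * k / m) acC'))) => s _.
- by rewrite /P2; ring.
- by rewrite /h; field.
Qed.

Let phi s := s * (L - s) / 2.
Let sh := sinhR t.
Let ch := coshR t.
Let chi s := m ^+ 2 * sh * phi s - (sh - S s - S' s).
Let chi1 s := m ^+ 2 * sh * (L / 2 - s) + m * C s - m * C' s.
(** A primitive of [chi], needed to integrate the constant term [N k] of [h] against [chi]. *)
Let X s := m ^+ 2 * sh * (L * s ^+ 2 / 4 - s ^+ 3 / 6)
  - (s * sh - C s / m + C' s / m).

Let acid := ac_on_id L.
Let ac1 := ac_on_cst L 1.

Let acphi : ac_on L phi (fun s => L / 2 - s).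
Proof.
apply: eq_ac_on (ac_onD (ac_onZ (L / 2) acid)
  (ac_onZ (- 2^-1) (ac_onM L0' acid acid))) => s _ /=.
- by rewrite /phi; field.
- by field.
Qed.

Let acchi : ac_on L chi chi1.
Proof.
apply: eq_ac_on (ac_onD (ac_onZ (m ^+ 2 * sh) acphi)
  (ac_onD (ac_onZ (- sh) ac1) (ac_onD acS acS'))) => s _ /=.
- by rewrite /chi; ring.
- by rewrite /chi1; ring.
Qed.

Let acchi1 : ac_on L chi1 (fun s => m ^+ 2 * (S s + S' s) - m ^+ 2 * sh).
Proof.
apply: eq_ac_on (ac_onD (ac_onZ (m ^+ 2 * sh * L / 2) ac1)
  (ac_onD (ac_onZ (- (m ^+ 2 * sh)) acid)
  (ac_onD (ac_onZ m acC) (ac_onZ (- m) acC')))) => s _ /=.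
- by rewrite /chi1; ring.
- by ring.
Qed.

Let acX : ac_on L X chi.
Proof.
apply: eq_ac_on (ac_onD (ac_onZ (m ^+ 2 * sh * L / 4) (ac_onM L0' acid acid))
  (ac_onD (ac_onZ (- (m ^+ 2 * sh / 6)) (ac_onM L0' acid (ac_onM L0' acid acid)))
  (ac_onD (ac_onZ (- sh) acid)
  (ac_onD (ac_onZ (m^-1) acC) (ac_onZ (- m^-1) acC'))))) => s _ /=.
- by rewrite /X; field.
- by rewrite /chi /phi; field.
Qed.

Let acK : ac_on L (int0^~ (fun s => phi s * v s)) (fun s => phi s * v s).
Proof.
by apply: ac_on_int0 => //; exact: ac_on_integrable (ac_onM L0' acphi acv).
Qed.

(* [chi] is [m^4 sinh(mL)] times the solution of [- psi'' + m^2 psi = phi]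
   with zero boundary values, so that pairing [h] with [chi] gives a multiple
   of [k]. *)
Let P3 s := chi1 s * v s - chi s * v1 s
  + m ^+ 4 * sh * int0 s (fun s => phi s * v s) + N * k * X s.

Let acP3 : ac_on L P3 (fun s => chi s * h s).
Proof.
apply: eq_ac_on (ac_onD (ac_onM L0' acchi1 acv)
  (ac_onD (ac_onZ (-1) (ac_onM L0' acchi acv1))
  (ac_onD (ac_onZ (m ^+ 4 * sh) acK) (ac_onZ (N * k) acX)))) => s _ /=.
- by rewrite /P3; ring.
- by rewrite /h /chi; ring.
Qed.

Let S_0 : S 0 = 0. Proof. by rewrite /S mulr0 sinhR0. Qed.
Let C_0 : C 0 = 1. Proof. by rewrite /C mulr0 coshR0. Qed.
Let S'_0 : S' 0 = sh. Proof. by rewrite /S' subr0. Qed.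
Let C'_0 : C' 0 = ch. Proof. by rewrite /C' subr0. Qed.
Let S_L : S L = sh. Proof. by []. Qed.
Let C_L : C L = ch. Proof. by []. Qed.
Let S'_L : S' L = 0. Proof. by rewrite /S' subrr mulr0 sinhR0. Qed.
Let C'_L : C' L = 1. Proof. by rewrite /C' subrr mulr0 coshR0. Qed.

Let t0 : 0 < t. Proof. exact: mulr_gt0. Qed.

(** The boundary terms drop out since [v] and [chi] vanish at both ends, so the integral of
    [chi * h] is an explicit multiple of [k]. *)
Let P3E : P3 L - P3 0 = k * (m ^+ 4 * sh + N * (X L - X 0)).
Proof.
rewrite /P3 int0_at0 -kE v0 vL.
have -> : chi 0 = 0 by rewrite /chi S_0 S'_0 /phi; ring.
have -> : chi L = 0 by rewrite /chi S_L S'_L /phi; ring.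
ring.
Qed.

(** This is [chi1 0], the slope of [chi] at 0. As [S] has slope [m] there, [chi0 / m] is the limit
    of [chi / S] at 0. *)
Let chi0 := m ^+ 2 * sh * L / 2 - m * (ch - 1).

Let chi0_gt0 : 0 < chi0.
Proof.
rewrite (_ : chi0 = m * (t / 2 * sh - (ch - 1))); last by rewrite /chi0 /t; field.
by rewrite mulr_gt0// subr_gt0 coshR_sub1_lt.
Qed.

Let m_sub x : x \in `[0, L] -> 0 <= m * x /\ m * x <= t.
Proof.
by rewrite in_itv/= => /andP[x0 xL]; rewrite mulr_ge0 ?ler_pM2l// ltW.
Qed.

Let addition x : S' x = sh * C x - ch * S x.
Proof.
have := coshR2_sinhR2 (m * x).
rewrite /sh /ch (_ : t = m * (L - x) + m * x); last by rewrite /t; ring.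
by rewrite sinhRD coshRD -/(S x) -/(C x) -/(S' x) -/(C' x) => e; rewrite -[LHS]mulr1 -e; ring.
Qed.

Let sh_split x : sh = S' x * C x + C' x * S x.
Proof.
by rewrite /sh (_ : t = m * (L - x) + m * x) ?sinhRD//; rewrite /t; ring.
Qed.

(** The ratio [chi / S] never exceeds its limit at 0: expanding [S'] by the subtraction formula, the
    gap is [m * sh] times the expression of [coshR_sub1_le] at [m * x]. *)
Let chi_le x : x \in `[0, L] -> m * chi x <= chi0 * S x.
Proof.
move=> /m_sub[x0 xt]; rewrite -subr_ge0.
have := coshR_sub1_le t (m * x) x0 xt; rewrite -/(S x) -/(C x).
have sh0 : 0 < m * sh by rewrite mulr_gt0// sinhR_gt0.
move=> /(mulr_ge0 (ltW sh0)); congr (0 <= _).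
by rewrite /chi addition /chi0 /phi /t; field.
Qed.

Let symm x : x \in `[0, L] -> L - x \in `[0, L].
Proof. by rewrite !in_itv/= => /andP[x0 xL]; rewrite subr_ge0 xL lerBlDr lerDl. Qed.

Let chi_le' x : x \in `[0, L] -> m * chi x <= chi0 * S' x.
Proof.
move=> /symm/chi_le; suff -> : chi (L - x) = chi x by [].
by rewrite /chi /S' /S /phi (_ : L - (L - x) = x); ring.
Qed.

Let S_ge0 x : x \in `[0, L] -> 0 <= S x.
Proof. by move=> /m_sub[x0 _]; exact: sinhR_ge0. Qed.
Let S'_ge0 x : x \in `[0, L] -> 0 <= S' x.
Proof. by move=> /symm; exact: S_ge0. Qed.
Let C_ge1 x : x \in `[0, L] -> 1 <= C x.
Proof. by move=> /m_sub[x0 _]; exact: coshR_ge1. Qed.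
Let C'_ge1 x : x \in `[0, L] -> 1 <= C' x.
Proof. by move=> /symm; exact: C_ge1. Qed.

(** By the subtraction formula for [S], the gap is [sh * (C' x - 1)]. The left side is [m ^+ 2 * sh]
    times the solution of [- w'' + m^2 w = 1] with zero boundary values. *)
Let sh_le x : x \in `[0, L] -> sh - S x - S' x <= (ch - 1) * S' x.
Proof.
move=> xL; rewrite -subr_ge0.
have sh0 : 0 < sh by exact: sinhR_gt0.
have := mulr_ge0 (ltW sh0) (etrans (subr_ge0 _ _) (C'_ge1 _ xL)).
congr (0 <= _).
have := addition (L - x); rewrite /S' /C (_ : L - (L - x) = x) -/(S x); last by ring.
by rewrite -/(C' x) -/(S (L - x)) => ->; rewrite /S' -/(S _); ring.
Qed.

Let sh_le' x : x \in `[0, L] -> sh - S x - S' x <= (ch - 1) * S x.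
Proof.
move=> /symm/sh_le; rewrite /S' (_ : L - (L - x) = x) -/(S x); last by ring.
by rewrite -/(S _) addrAC.
Qed.

(** The Green formula writes [v x] as a nonnegative term minus a multiple of [k], so only [k > 0]
    can do harm. In that case the nonnegative term is bounded below by a multiple of [k], using the
    integral of [h] against [chi], and [Nle] says that this multiple is large enough. *)
Lemma helmholtz_ge0 x : x \in `[0, L] -> 0 <= v x.
Proof.
move=> xL; have /andP[x0 xL'] : 0 <= x <= L by rewrite -mem_itv0.
have oc z : z \in `]0, L[ -> z \in `[0, L] by exact: subset_itv_oo_cc.
have p1 : 0 <= P1 x - P1 0.
  rewrite subr_ge0; apply: (ac_on_homo _ _ _ _ _ acP1) => //.
  by apply: ae0L_imp h0 => z /oc/S_ge0 ? ?; exact: mulr_ge0.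
have p2 : 0 <= P2 x - P2 L.
  rewrite subr_ge0; apply: (ac_on_antitone _ _ _ _ _ acP2) => //.
  by apply: ae0L_imp h0 => z /oc/S'_ge0 ? ?; rewrite oppr_le0; exact: mulr_ge0.
have sh0 : 0 < sh by exact: sinhR_gt0.
have msh0 : 0 < m * sh by exact: mulr_gt0.
set E := sh - S x - S' x.
have E0 : 0 <= E.
  rewrite /E {1}(sh_split x) (_ : _ - _ = S' x * (C x - 1) + (C' x - 1) * S x); last
    by ring.
  by apply: addr_ge0; apply: mulr_ge0; rewrite ?subr_ge0;
    [exact: S'_ge0|exact: C_ge1|exact: C'_ge1|exact: S_ge0].
(* Green's formula at [x]: the combination with weights [S' x] and [S x] eliminates [v1 x]. *)
have I : S' x * (P1 x - P1 0) + S x * (P2 x - P2 L) = m * sh * v x + N * k / m * E.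
  rewrite /P1 /P2 v0 vL S_0 C_0 S'_L C'_L /E (sh_split x); field.
  exact: mn0.
have I0 : 0 <= m * sh * v x + N * k / m * E.
  by rewrite -I; apply: addr_ge0; apply: mulr_ge0 => //; [exact: S'_ge0|exact: S_ge0].
have [k0|k0] := leP k 0.
  rewrite -(pmulr_rge0 _ msh0); apply: (le_trans I0).
  rewrite gerDl mulr_le0_ge0// mulr_le0_ge0 ?invr_ge0 ?(ltW m0)//.
  by rewrite mulr_ge0_le0// ltW.
(* [chi] is compared with [S] on [[0, x]] here and with [S'] on [[x, L]] in [q2]; the sum [q4]
   bounds [k] by the two Green integrals. *)
have q1 : m * (P3 x - P3 0) <= chi0 * (P1 x - P1 0).
  have acQ := ac_onD (ac_onZ chi0 acP1) (ac_onZ (- m) acP3).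
  have Q0 : ae0L L (fun z => 0 <= chi0 * (S z * h z) + - m * (chi z * h z)).
    apply: ae0L_imp h0 => z /oc zL hz.
    rewrite (_ : _ + _ = (chi0 * S z - m * chi z) * h z); last by ring.
    by rewrite mulr_ge0// subr_ge0 chi_le.
  have := ac_on_homo _ _ _ _ _ acQ Q0 (lexx _) x0 xL'; lra.
have q2 : m * (P3 L - P3 x) <= chi0 * (P2 x - P2 L).
  have acQ := ac_onD (ac_onZ chi0 acP2) (ac_onZ m acP3).
  have Q0 : ae0L L (fun z => chi0 * - (S' z * h z) + m * (chi z * h z) <= 0).
    apply: ae0L_imp h0 => z /oc zL hz.
    rewrite (_ : _ + _ = - ((chi0 * S' z - m * chi z) * h z)); last by ring.
    by rewrite oppr_le0 mulr_ge0// subr_ge0 chi_le'.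
  have := ac_on_antitone _ _ _ _ _ acQ Q0 x0 xL' (lexx _); lra.
have ch1 : 0 < ch - 1 by rewrite subr_gt0 coshR_gt1.
(* The unweighted sum of the two Green integrals, to which [q4] applies, is traded for the weighted
   one in [I] by means of [sh_le] and [sh_le']. *)
have q3 : E * (P1 x - P1 0 + (P2 x - P2 L)) <= (ch - 1) * (m * sh * v x + N * k / m * E).
  rewrite -I (_ : (ch - 1) * _
    = (ch - 1) * S' x * (P1 x - P1 0) + (ch - 1) * S x * (P2 x - P2 L)); last by ring.
  rewrite mulrDr; apply: lerD; apply: ler_wpM2r => //; [exact: sh_le|exact: sh_le'].
have q4 : m * (k * (m ^+ 4 * sh + N * (X L - X 0)))
  <= chi0 * (P1 x - P1 0 + (P2 x - P2 L)).
  by rewrite -P3E; move: q1 q2; lra.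
have q5 : E * (m * (k * (m ^+ 4 * sh + N * (X L - X 0))))
  <= chi0 * ((ch - 1) * (m * sh * v x + N * k / m * E)).
  apply: le_trans (ler_wpM2l (ltW chi0_gt0) q3); rewrite [leRHS]mulrCA.
  exact: ler_wpM2l.
(* Modulo [ch ^+ 2 - sh ^+ 2 = 1], twelve times this bracket is [sh] times the slack in [Nle]; the
   argument [11] below encodes the positivity of [12]. *)
have br : 0 <= m ^+ 5 * sh + m * N * (X L - X 0) - chi0 * (ch - 1) * (N / m).
  rewrite -(pmulr_rge0 _ (ltr0Sn R 11)).
  have := mulr_ge0 (ltW sh0) (etrans (subr_ge0 _ _) Nle); congr (0 <= _).
  have := coshR2_sinhR2 t; rewrite -/sh -/ch => e.
  apply/eqP; rewrite -subr_eq0; apply/eqP.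
  transitivity (12 * N * (1 - (ch ^+ 2 - sh ^+ 2))); last by rewrite e subrr mulr0.
  by rewrite /X /chi0 C_0 C'_0 C_L C'_L -/ch -/sh /t; field.
have fin : 0 <= chi0 * (ch - 1) * (m * sh) * v x.
  have := mulr_ge0 (mulr_ge0 E0 (ltW k0)) br; move/le_trans; apply.
  rewrite -subr_ge0; move: q5; rewrite -subr_ge0; congr (0 <= _).
  ring.
have pos : 0 < chi0 * (ch - 1) * (m * sh).
  by apply: mulr_gt0 => //; exact: mulr_gt0.
by rewrite -(pmulr_rge0 _ pos).
Qed.

End helmholtz.
End maximum_principle.

(** * The maximum principle for the hinged fourth-order operator *)

Section fourth_order.
Context {R : realType}.
Local Notation mu := (@lebesgue_measure R).

(** [W41] asks integrability of [w4] only; going down the chain, each lower derivative is a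
    primitive, hence continuous, hence integrable on [[0, L]]. *)
Lemma W41_ac_on (L : R) (w w1 w2 w3 w4 : R -> R) : 0 <= L ->
  W41 L w w1 w2 w3 w4 <->
  [/\ ac_on L w w1, ac_on L w1 w2, ac_on L w2 w3 & ac_on L w3 w4].
Proof.
move=> L0; split=> [[w4i wE]|[[_ e0] [_ e1] [_ e2] [w4i e3]]]; last first.
  by split=> // x xL; split; [exact: e0|exact: e1|exact: e2|exact: e3].
have ac3 : ac_on L w3 w4 by split=> // x /wE[].
have ac2 : ac_on L w2 w3.
  by split; [exact: ac_on_integrable ac3|move=> x /wE[]].
have ac1 : ac_on L w1 w2.
  by split; [exact: ac_on_integrable ac2|move=> x /wE[]].
by split=> //; split; [exact: ac_on_integrable ac1|move=> x /wE[]].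
Qed.

Lemma W41D (L : R) (w w1 w2 w3 w4 z z1 z2 z3 z4 : R -> R) r : 0 <= L ->
  W41 L w w1 w2 w3 w4 -> W41 L z z1 z2 z3 z4 ->
  W41 L (fun x => w x + r * z x) (fun x => w1 x + r * z1 x)
    (fun x => w2 x + r * z2 x) (fun x => w3 x + r * z3 x)
    (fun x => w4 x + r * z4 x).
Proof.
move=> L0 /(W41_ac_on _ _ _ _ _ _ L0)[? ? ? ?] /(W41_ac_on _ _ _ _ _ _ L0)[? ? ? ?].
by apply/W41_ac_on => //; split; apply: ac_onD => //; exact: ac_onZ.
Qed.

Lemma ac_on_homo_on (L : R) (F f : R -> R) x y : ac_on L F f ->
  0 <= x -> x <= y -> y <= L -> {in `[x, y], forall z, 0 <= f z} -> F x <= F y.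
Proof.
move=> [fi FE] x0 xy yL f0.
rewrite (FE x) ?(FE y) ?lerD2l ?in_itv/= ?x0 ?yL ?(le_trans xy yL) ?(le_trans x0 xy)//.
rewrite -subr_ge0 /int0 Rintegral_itvB ?bnd_simp//; last first.
  exact: integrable_sub_itv0 fi.
apply: Rintegral_ge0 => z /=; rewrite in_itv/= => /andP[xz zy].
by apply: f0; rewrite in_itv/= zy ltW.
Qed.

(** As [u1] decreases, comparing [u] with its tangent slope at [x] on either side gives
    [x * u1 x <= u x] and [- (L - x) * u1 x <= u x]. Weighted by [L - x] and [x], these add up to
    [0 <= L * u x]. *)
Lemma concave_ge0 (L : R) (u u1 u2 : R -> R) : 0 < L ->
  ac_on L u u1 -> ac_on L u1 u2 -> u 0 = 0 -> u L = 0 ->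
  (forall x, x \in `[0, L] -> u2 x <= 0) ->
  forall x, x \in `[0, L] -> 0 <= u x.
Proof.
move=> L0 acu acu1 u0 uL u2le x.
rewrite in_itv/= => /andP[x0 xL].
have u1_anti y z : 0 <= y -> y <= z -> z <= L -> u1 z <= u1 y.
  apply: (ac_on_antitone _ _ _ _ _ acu1).
  apply: negligibleS (negligible_set0 mu) => s /= [sL]; apply; apply: u2le.
  exact: subset_itv_oo_cc sL.
have acl r : ac_on L (fun s => u s + r * s) (fun s => u1 s + r * 1).
  exact: ac_onD acu (ac_onZ r (ac_on_id L)).
have H1 : x * u1 x <= u x.
  have := ac_on_homo_on _ _ _ 0 x (acl (- u1 x)) (lexx _) x0 xL.
  rewrite u0 mulr0 addr0 => H; suff : 0 <= u x + - u1 x * x by lra.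
  apply: H => s; rewrite in_itv/= => /andP[s0 sx].
  by rewrite mulr1 subr_ge0 u1_anti.
have H2 : - ((L - x) * u1 x) <= u x.
  have := ac_on_homo_on _ _ _ x L (ac_onZ (-1) (acl (- u1 x))) x0 xL (lexx _).
  rewrite uL => H; suff : -1 * (u x + - u1 x * x) <= -1 * (0 + - u1 x * L) by lra.
  apply: H => s; rewrite in_itv/= => /andP[xs sL].
  by rewrite mulr1 mulN1r oppr_ge0 subr_le0 u1_anti.
have : 0 <= L * u x.
  have := ler_wpM2l x0 H2.
  have Lx : 0 <= L - x by rewrite subr_ge0.
  have := ler_wpM2l Lx H1.
  by lra.
by rewrite pmulr_rge0.
Qed.

Lemma max_principle (L M N : R) (u u1 u2 u3 u4 : R -> R) :
  0 < L -> 0 < M -> 0 < N ->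
  N <= 4 * M / L ^+ 3 * sigma (Num.sqrt M * L) ->
  W41 L u u1 u2 u3 u4 -> BC L u u2 ->
  ae0L L (fun x => 0 <= u4 x - M * u2 x + N * int0 L u) ->
  forall x, x \in `[0, L] -> 0 <= u x /\ u2 x <= 0.
Proof.
move=> L0 M0 N0 NM wu [u0 [uL [u20 u2L]]] h0.
have L0' := ltW L0.
have [ac0 ac1 ac2 ac3] := (W41_ac_on _ _ _ _ _ _ L0').1 wu.
set m := Num.sqrt M.
have m0 : 0 < m by rewrite sqrtr_gt0.
have mM : m ^+ 2 = M by rewrite sqr_sqrtr// ltW.
have Nle : N * (6 * (m * L) * coshR (m * L) + 6 * (m * L)
    - 12 * sinhR (m * L) - (m * L) ^+ 3) <= 12 * m ^+ 5.
  move: NM; rewrite /sigma -/m -mM; set D := (X in N * X).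
  rewrite (_ : 4 * m ^+ 2 / L ^+ 3 * (3 * (m * L) ^+ 3 / D) = 12 * m ^+ 5 / D);
    last first.
    rewrite mulrA; congr (_ / D); field; exact: lt0r_neq0.
  (* Positivity of the denominator of [sigma] is read off from the bound itself:
     [0 < N <= 12 m^5 / D] forces [D > 0]. *)
  move=> NM; have D0 : 0 < D.
    rewrite -invr_gt0 -(pmulr_rgt0 _ (_ : 0 < 12 * m ^+ 5)).
      exact: lt_le_trans NM.
    by rewrite mulr_gt0// exprn_gt0.
  by rewrite -ler_pdivlMr.
(* With [phi s = s (L - s) / 2], so that [phi'' = -1], the function [phi u' - phi' u] has derivative
   [phi u'' + u] and vanishes at both ends. *)
have kE : int0 L u = int0 L (fun s => s * (L - s) / 2 * (-1 * u2 s)).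
  have acphi : ac_on L (fun s => s * (L - s) / 2) (fun s => L / 2 - s).
    apply: eq_ac_on (ac_onD (ac_onZ (L / 2) (ac_on_id L))
      (ac_onZ (- 2^-1) (ac_onM L0' (ac_on_id L) (ac_on_id L)))) => s _ /=.
    - by field.
    - by field.
  have acphi1 : ac_on L (fun s => L / 2 - s) (fun=> -1).
    apply: eq_ac_on (ac_onD (ac_onZ (L / 2) (ac_on_cst L 1))
      (ac_onZ (-1) (ac_on_id L))) => s _ /=; ring.
  have acp : ac_on L (fun s => s * (L - s) / 2 * (-1 * u2 s)) (fun s => (L / 2 - s) * (-1 * u2 s) + s * (L - s) / 2 * (-1 * u3 s)).
    exact: ac_onM _ acphi (ac_onZ _ ac2).
  have ui := ac_on_integrable _ _ _ L0' ac0.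
  have pi := ac_on_integrable _ _ _ L0' acp.
  have acQ := ac_onD (ac_onM L0' acphi ac1)
     (ac_onZ (-1) (ac_onM L0' acphi1 ac0)).
  have [_ /(_ L)] := acQ; rewrite in_itv/= L0' lexx => /(_ isT).
  rewrite u0 uL !mul0r subr0 subrr mulr0 !mul0r !mulr0 !addr0.
  rewrite (@eq_int0 _ L _ (fun s => u s + (-1) * (s * (L - s) / 2 * (-1 * u2 s))));
    last first.
    by move=> s _ /=; ring.
  rewrite (int0D L)//; last exact: integrableZ_fun.
  rewrite (int0Z L)// => e; lra.
have v0 x : x \in `[0, L] -> 0 <= -1 * u2 x.
  apply: (helmholtz_ge0 L m N (int0 L u) (fun x => -1 * u2 x)
    (fun x => -1 * u3 x) (fun x => -1 * u4 x)) => //.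
  - exact: ac_onZ.
  - exact: ac_onZ.
  - by rewrite u20 mulr0.
  - by rewrite u2L mulr0.
  - by apply: ae0L_imp h0 => z _; rewrite mM; congr (0 <= _); ring.
have u2le x : x \in `[0, L] -> u2 x <= 0 by move=> /v0; rewrite mulN1r oppr_ge0.
by move=> x xL; split; [exact: (concave_ge0 _ _ _ _ L0 ac0 ac1 u0 uL)|exact: u2le].
Qed.

End fourth_order.

(** * Uniform limits of primitives under dominated convergence *)

Section dominated_limits.
Context {R : realType}.
Local Notation mu := (@lebesgue_measure R).
Implicit Types (L : R) (F f : nat -> R -> R) (g finf : R -> R).

Lemma unif_cvg_pointwise L F finf x : unif_cvg L F finf -> x \in `[0, L] ->
  F n x @[n --> \oo] --> finf x.
Proof.
move=> Ff xL; apply/cvgrPdist_lt => e e0; have [n0 Hn] := Ff e e0.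
by exists n0 => // n /= nn0; rewrite distrC; exact: Hn.
Qed.

Lemma int0_norm_le L g h x : mu.-integrable `[0, L] (EFin \o g) ->
  mu.-integrable `[0, L] (EFin \o h) ->
  {in `[0, L], forall z, `|h z| <= g z} -> x \in `[0, L] ->
  `|int0 x h| <= int0 L g.
Proof.
move=> gi hi hg; rewrite in_itv/= => /andP[x0 xL].
have ni : mu.-integrable `[0, L] (EFin \o (fun z => `|h z|)).
  exact: (integrable_norm hi).
apply: (@le_trans _ _ (int0 x (fun z => `|h z|))).
  by apply: le_normr_Rintegral => //; exact: integrable_sub_itv0 hi.
apply: (@le_trans _ _ (int0 L (fun z => `|h z|))).
  apply: (int0_homo L) => //.
  by apply: negligibleS (negligible_set0 mu) => z /= [_]; apply.
exact: (le_int0 L).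
Qed.

(** Dominated convergence makes [f n] converge in L1, and the L1 distance bounds the distance of the
    primitives at every [x] at once. *)
Lemma ac_on_dominated L F f g finf (r : R) : 0 <= L ->
  (forall n, ac_on L (F n) (f n)) ->
  {in `[0, L], forall x, f n x @[n --> \oo] --> finf x} ->
  mu.-integrable `[0, L] (EFin \o g) ->
  (forall n, {in `[0, L], forall x, `|f n x| <= g x}) ->
  F n 0 @[n --> \oo] --> r ->
  ac_on L (fun x => r + int0 x finf) finf /\
  unif_cvg L F (fun x => r + int0 x finf).
Proof.
move=> L0 acF ff gi fg F0.
have fi n : mu.-integrable `[0, L] (EFin \o f n) by case: (acF n).
have mf n : measurable_fun `[0, L] (f n).
  by apply/measurable_EFinP; exact: measurable_int (fi n).
have mfi : measurable_fun `[0, L] finf.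
  by apply: (measurable_fun_cvg mf) => x xL; exact: ff.
have [||||] := @dominated_convergence _ _ R mu `[0, L]%classic (measurable_itv _)
  (fun n => EFin \o f n) (EFin \o finf) (EFin \o g) _ _ _ gi _.
- by move=> n; exact: measurable_int (fi n).
- exact/measurable_EFinP.
- by apply/aeW => x xL; apply: cvg_EFin; [exact: nearW|exact: ff].
- by apply/aeW => x n xL; rewrite /= lee_fin; exact: fg.
move=> fii cv _; split.
  by split=> // x _; rewrite int0_at0 addr0.
have di n : mu.-integrable `[0, L] (EFin \o (fun x => `|f n x - finf x|)).
  have := integrableD_fun _ _ _ (measurable_itv _) (fi n)
    (integrableZ_fun _ _ (-1) (measurable_itv _) fii).
  move=> /integrable_norm; apply: eq_integrable_itv0.
  by move=> x _ /=; rewrite mulN1r.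
have {}cv : int0 L (fun x => `|f n x - finf x|) @[n --> \oo] --> 0.
  by have /fine_cvgP[_] := cv.
move=> e e0.
have e2 : 0 < e / 2 by rewrite divr_gt0.
have /cvgrPdist_lt/(_ _ e2)[n1 _ H1] := cv.
have /cvgrPdist_lt/(_ _ e2)[n2 _ H2] := F0.
exists (maxn n1 n2) => n; rewrite geq_max => /andP[n1n n2n] x xL.
have [_ FE] := acF n; rewrite (FE _ xL).
have xL' : x <= L by case/andP: xL.
have -> : F n 0 + int0 x (f n) - (r + int0 x finf) =
    (F n 0 - r) + int0 x (fun z => f n z + (-1) * finf z).
  by rewrite (int0D L)// ?(int0Z L)//; [ring|exact: integrableZ_fun].
apply: (le_lt_trans (ler_normD _ _)).
rewrite [e](_ : e = e / 2 + e / 2); last by field.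
apply: ltr_leD; first by rewrite distrC; exact: H2.
apply: le_trans (ltW (H1 _ n1n)); rewrite sub0r normrN.
apply: le_trans (ler_norm _).
apply: (int0_norm_le L) => //.
- by apply: integrableD_fun => //; exact: integrableZ_fun.
- by move=> z _; rewrite mulN1r.
Qed.

(** Only the second derivatives [z n] are controlled. Integrating twice leaves the unknown slope
    [Y n 0], and [W n L = 0] expresses it through the double primitive [J n] at [L], which
    converges. *)
Lemma dirichlet_dominated L (W Y z : nat -> R -> R) g zinf : 0 < L ->
  (forall n, ac_on L (W n) (Y n)) -> (forall n, ac_on L (Y n) (z n)) ->
  (forall n, W n 0 = 0) -> (forall n, W n L = 0) ->
  {in `[0, L], forall x, z n x @[n --> \oo] --> zinf x} ->
  mu.-integrable `[0, L] (EFin \o g) ->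
  (forall n, {in `[0, L], forall x, `|z n x| <= g x}) ->
  exists Winf Yinf, [/\ ac_on L Winf Yinf, ac_on L Yinf zinf,
    Winf 0 = 0, Winf L = 0 & unif_cvg L W Winf].
Proof.
move=> L0 acW acY W0 WL zz gi zg; have L0' := ltW L0.
have memL : L \in `[0, L] by rewrite in_itv/= L0' lexx.
have mem0 : 0 \in `[0, L] by rewrite in_itv/= L0' lexx.
have zi n : mu.-integrable `[0, L] (EFin \o z n) by case: (acY n).
pose K n x := int0 x (z n).
have acK n : ac_on L (K n) (z n) by exact: ac_on_int0.
have K0 : K n 0 @[n --> \oo] --> 0.
  by under eq_cvg do rewrite /K int0_at0; exact: cvg_cst.
have [acKi Kcvg] := ac_on_dominated _ _ _ _ _ _ L0' acK zz gi zg K0.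
have Ki n : mu.-integrable `[0, L] (EFin \o K n) by exact: ac_on_integrable (acK n).
have KB n : {in `[0, L], forall x, `|K n x| <= int0 L g}.
  by move=> x xL; exact: int0_norm_le (zg n) xL.
pose J n x := int0 x (K n).
have acJ n : ac_on L (J n) (K n) by exact: ac_on_int0.
have J0 : J n 0 @[n --> \oo] --> 0.
  by under eq_cvg do rewrite /J int0_at0; exact: cvg_cst.
have [acJi Jcvg] := ac_on_dominated _ _ _ _ _ _ L0' acJ
  (fun x => unif_cvg_pointwise _ _ _ _ Kcvg) (integrable_cst_itv0 L _) KB J0.
have WE n x : x \in `[0, L] -> W n x = Y n 0 * x + J n x.
  move=> xL; have /andP[x0 xL'] : 0 <= x <= L by rewrite -mem_itv0.
  have [_ ->//] := acW n; rewrite W0 add0r.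
  rewrite (@eq_int0 _ x _ (fun s => Y n 0 + K n s)); last first.
    move=> s; rewrite in_itv/= => /andP[s0 sx]; have [_ ->//] := acY n.
    by rewrite in_itv/= s0 (le_trans sx).
  rewrite (int0D L)// ?int0_cst//; exact: integrable_cst_itv0.
set Ki_ := fun x => 0 + int0 x zinf in acKi Kcvg acJi Jcvg *.
set Ji_ := fun x => 0 + int0 x Ki_ in acJi Jcvg *.
pose d := - Ji_ L / L.
have YE n : Y n 0 = - J n L / L.
  have := WE n _ memL; rewrite WL => e; apply/(canRL (mulfK _)); first by rewrite gt_eqF.
  lra.
have dcvg : Y n 0 @[n --> \oo] --> d.
  under eq_cvg do rewrite YE.
  apply: cvgMl; apply: cvgN; exact: unif_cvg_pointwise Jcvg memL.
exists (fun x => d * x + Ji_ x), (fun x => d * 1 + Ki_ x); split.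
- exact: ac_onD (ac_onZ d (ac_on_id L)) acJi.
- apply: eq_ac_on (ac_onD (ac_onZ (d * 1) (ac_on_cst L 1)) acKi) => x _ /=.
  + by rewrite mulr1.
  + by rewrite mulr0 add0r.
- by rewrite /Ji_ int0_at0 mulr0 !addr0.
- by rewrite /d divfK ?gt_eqF// addNr.
move=> e e0.
have e2 : 0 < e / 2 by rewrite divr_gt0.
have eL : 0 < e / 2 / L by rewrite divr_gt0.
have /cvgrPdist_lt/(_ _ eL)[n1 _ H1] := dcvg.
have [n2 H2] := Jcvg _ e2.
exists (maxn n1 n2) => n; rewrite geq_max => /andP[n1n n2n] x xL.
have /andP[x0 xL'] : 0 <= x <= L by rewrite -mem_itv0.
rewrite WE// (_ : _ - _ = (Y n 0 - d) * x + (J n x - Ji_ x)); last by ring.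
apply: (le_lt_trans (ler_normD _ _)).
rewrite [e](_ : e = e / 2 + e / 2); last by field.
apply: ler_ltD; last exact: H2.
rewrite normrM (ger0_norm x0) distrC.
rewrite -[leRHS](divfK (_ : L != 0)) ?gt_eqF//.
by apply: ler_pM => //; exact/ltW/H1.
Qed.

End dominated_limits.

(** * Order preservation and limits of the iteration *)

Section monotone_iteration.
Context {R : realType}.
Local Notation mu := (@lebesgue_measure R).
Variables (L a b c M N : R) (p : R -> R).
Hypotheses (L0 : 0 < L) (b0 : 0 < b) (M0 : 0 < M) (N0 : 0 < N).
Hypothesis pi : mu.-integrable `[0, L] (EFin \o p).
Hypothesis NM : N <= 4 * M / L ^+ 3 * sigma (Num.sqrt M * L).

Let L0' : 0 <= L. Proof. exact: ltW. Qed.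

Definition iter_lhs (y y2 y4 : R -> R) x := y4 x - M * y2 x + N * int0 L y.

Definition iter_rhs (z z2 : R -> R) x :=
  p x + (a + b * int0 L z) * z2 x - c * int0 L z - M * z2 x + N * int0 L z.

Definition ord2 (z z2 w w2 : R -> R) :=
  forall x, x \in `[0, L] -> z x <= w x /\ w2 x <= z2 x.

(** Inequality versions of one iteration step from [z]. An iterate satisfies both; a lower (upper)
    solution is a sub-step (super-step) from itself, so a single comparison lemma covers all
    cases. *)
Definition sub_step (z z2 y y1 y2 y3 y4 : R -> R) :=
  [/\ W41 L y y1 y2 y3 y4,
      ae0L L (fun x => iter_lhs y y2 y4 x <= iter_rhs z z2 x) & BC L y y2].

Definition sup_step (z z2 y y1 y2 y3 y4 : R -> R) :=
  [/\ W41 L y y1 y2 y3 y4,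
      ae0L L (fun x => iter_rhs z z2 x <= iter_lhs y y2 y4 x) & BC L y y2].

Lemma ord2_trans z z2 y y2 w w2 :
  ord2 z z2 y y2 -> ord2 y y2 w w2 -> ord2 z z2 w w2.
Proof.
move=> zy yw x xL; have [? ?] := zy x xL; have [? ?] := yw x xL.
by split; lra.
Qed.

Lemma ord2_refl z z2 : ord2 z z2 z z2. Proof. by []. Qed.

Lemma W41_integrable w w1 w2 w3 w4 : W41 L w w1 w2 w3 w4 ->
  mu.-integrable `[0, L] (EFin \o w).
Proof. by move=> /(W41_ac_on _ _ _ _ _ _ L0')[+ _ _ _]; exact: ac_on_integrable. Qed.

(** The right-hand side of the iteration is monotone below [be], and the maximum principle applied
    to [u - y] carries the inequality over to the next step. *)
Lemma ord2_step z z2 w w2 be be2 y y1 y2 y3 y4 u u1 u2 u3 u4 :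
  mu.-integrable `[0, L] (EFin \o z) -> mu.-integrable `[0, L] (EFin \o w) ->
  mu.-integrable `[0, L] (EFin \o be) ->
  a + b * int0 L be <= M -> (forall x, x \in `[0, L] -> c - b * be2 x <= N) ->
  ord2 z z2 w w2 -> ord2 w w2 be be2 ->
  sub_step z z2 y y1 y2 y3 y4 -> sup_step w w2 u u1 u2 u3 u4 ->
  ord2 y y2 u u2.
Proof.
move=> zi wi bei aM cN zw wbe [Wy ley [y0 [yL [y20 y2L]]]] [Wu leu [u0 [uL [u20 u2L]]]].
have Izw : int0 L z <= int0 L w by apply: (le_int0 L) => // x /zw[].
have Iwb : int0 L w <= int0 L be by apply: (le_int0 L) => // x /wbe[].
have rhs_le x : x \in `[0, L] -> iter_rhs z z2 x <= iter_rhs w w2 x.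
  move=> xL; have [_ wz] := zw x xL; have [_ bw] := wbe x xL.
  have cNx := cN x xL.
  (* All four factors are nonnegative: the first by the bound on [a + b * int0 L be], the last by
     [c - b * be2 x <= N] and [be2 x <= z2 x]. *)
  rewrite -subr_ge0 (_ : _ - _ = (M - (a + b * int0 L w)) * (z2 x - w2 x)
     + (int0 L w - int0 L z) * (b * z2 x + N - c)); last by rewrite /iter_rhs; ring.
  apply: addr_ge0; apply: mulr_ge0; rewrite ?subr_ge0//.
    by apply: le_trans aM; rewrite lerD2l ler_pM2l.
  suff : b * be2 x <= b * z2 x by lra.
  by rewrite ler_pM2l//; exact: le_trans wz.
have WD := W41D _ _ _ _ _ _ _ _ _ _ _ (-1) L0' Wu Wy.
have yi := W41_integrable _ _ _ _ _ Wy.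
have ui := W41_integrable _ _ _ _ _ Wu.
have H := max_principle _ _ _ _ _ _ _ _ L0 M0 N0 NM WD.
move=> x xL; have [| |] := H _ _ x xL.
- by rewrite /BC u0 y0 uL yL u20 y20 u2L y2L mulr0 addr0.
- rewrite (int0D L)//; last exact: integrableZ_fun.
  rewrite (int0Z L)//.
  apply: negligibleS (negligibleU ley leu) => s /= [sL] n.
  have sL' : s \in `[0, L] by exact: subset_itv_oo_cc.
  apply: contrapT => /not_orP[n1 n2]; apply: n.
  have {}n1 : iter_lhs y y2 y4 s <= iter_rhs z z2 s.
    by apply: contrapT => n; apply: n1.
  have {}n2 : iter_rhs w w2 s <= iter_lhs u u2 u4 s.
    by apply: contrapT => n; apply: n2.
  have := le_trans n1 (le_trans (rhs_le _ sL') n2); rewrite /iter_lhs; lra.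
by move=> ? ?; split; lra.
Qed.

Lemma iter_sub_step z z2 y y1 y2 y3 y4 :
  is_iterP L a b c M N p z z2 y y1 y2 y3 y4 -> sub_step z z2 y y1 y2 y3 y4.
Proof.
by move=> [? e ?]; split=> //; apply: ae0L_imp e => x _;
  rewrite /iter_lhs /iter_rhs => ->.
Qed.

Lemma iter_sup_step z z2 y y1 y2 y3 y4 :
  is_iterP L a b c M N p z z2 y y1 y2 y3 y4 -> sup_step z z2 y y1 y2 y3 y4.
Proof.
by move=> [? e ?]; split=> //; apply: ae0L_imp e => x _;
  rewrite /iter_lhs /iter_rhs => ->.
Qed.

Lemma lower_sub_step y y1 y2 y3 y4 :
  is_lowerP L a b c p y y1 y2 y3 y4 -> sub_step y y2 y y1 y2 y3 y4.
Proof.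
move=> [? e ?]; split=> //; apply: ae0L_imp e => x _.
by rewrite /iter_lhs /iter_rhs /Pop => e; lra.
Qed.

Lemma upper_sup_step y y1 y2 y3 y4 :
  is_upperP L a b c p y y1 y2 y3 y4 -> sup_step y y2 y y1 y2 y3 y4.
Proof.
move=> [? e ?]; split=> //; apply: ae0L_imp e => x _.
by rewrite /iter_lhs /iter_rhs /Pop => e; lra.
Qed.

Lemma sol_lower y y1 y2 y3 y4 :
  is_solP L a b c p y y1 y2 y3 y4 -> is_lowerP L a b c p y y1 y2 y3 y4.
Proof. by move=> [? e ?]; split=> //; apply: ae0L_imp e => x _ ->. Qed.

Lemma sol_upper y y1 y2 y3 y4 :
  is_solP L a b c p y y1 y2 y3 y4 -> is_upperP L a b c p y y1 y2 y3 y4.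
Proof. by move=> [? e ?]; split=> //; apply: ae0L_imp e => x _ ->. Qed.

(** The limits [l2] and [I] are at first unrelated to any function. [dirichlet_dominated] is applied
    to the second derivatives and then to the iterates themselves, and uniqueness of limits
    identifies [l2] with [y2] and [I] with the integral of [y]. *)
Lemma iter_limit (u u1 u2 u3 u4 : nat -> R -> R) (B I : R) (l2 : R -> R) :
  (forall n, is_iterP L a b c M N p (u n) (u2 n)
     (u n.+1) (u1 n.+1) (u2 n.+1) (u3 n.+1) (u4 n.+1)) ->
  W41 L (u 0%N) (u1 0%N) (u2 0%N) (u3 0%N) (u4 0%N) ->
  (forall n, {in `[0, L], forall x, `|u2 n x| <= B}) ->
  {in `[0, L], forall x, u2 n x @[n --> \oo] --> l2 x} ->
  int0 L (u n) @[n --> \oo] --> I ->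
  exists y y1 y2 y3 y4, [/\ is_solP L a b c p y y1 y2 y3 y4,
    unif_cvg L u y & {in `[0, L], forall x, u2 n x @[n --> \oo] --> y2 x}].
Proof.
move=> it W0 uB u2l uI.
have ac n : [/\ ac_on L (u n) (u1 n), ac_on L (u1 n) (u2 n),
    ac_on L (u2 n) (u3 n) & ac_on L (u3 n) (u4 n)].
  by apply/W41_ac_on => //; case: n => // n; case: (it n).
have u2i n : mu.-integrable `[0, L] (EFin \o u2 n).
  by have [_ _ + _] := ac n; exact: ac_on_integrable.
(* The right-hand side, which is only a.e. equal to [u4 n.+1], replaces it. *)
pose f n x := iter_rhs (u n) (u2 n) x + M * u2 n.+1 x - N * int0 L (u n.+1).
have fE n : f n = (fun x => p x + (((a + b * int0 L (u n) - M) * u2 n x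
    + M * u2 n.+1 x) + (N * int0 L (u n) - c * int0 L (u n) - N * int0 L (u n.+1)))).
  by apply/funext => x; rewrite /f /iter_rhs; ring.
have fi n : mu.-integrable `[0, L] (EFin \o f n).
  rewrite fE; apply: integrableD_fun => //; apply: integrableD_fun => //.
    by apply: integrableD_fun => //; exact: integrableZ_fun.
  exact: integrable_cst_itv0.
have ac3 n : ac_on L (u3 n.+1) (f n).
  split=> // x xL; have [_ _ _ [u4i ->//]] := ac n.+1; congr (_ + _).
  apply: (ae_eq_int0 L) => //; first by case/andP: xL.
  have [_ e _] := it n; apply: ae0L_imp e => s _.
  by rewrite /f /iter_rhs; lra.
have [BI IB] : exists BI, forall n, `|int0 L (u n)| <= BI.
  have /cvg_seq_bounded[K [_ HK]] : cvgn (fun n => int0 L (u n))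
    by apply/cvg_ex; exists I.
  by exists (K + 1) => n; apply: HK => //; rewrite ltrDl.
have B0 : 0 <= B.
  apply: le_trans (normr_ge0 _) (uB 0%N 0 _).
  by rewrite in_itv/= lexx.
have BI0 : 0 <= BI by exact: le_trans (normr_ge0 _) (IB 0%N).
(* The limit of [f], kept in the same shape; the terms in [M] and [N] cancel, leaving the fourth
   derivative prescribed by the problem. *)
pose l4 x := p x + (((a + b * I - M) * l2 x + M * l2 x) + (N * I - c * I - N * I)).
have f_l4 : {in `[0, L], forall x, f n x @[n --> \oo] --> l4 x}.
  move=> x xL; have u2lx := u2l x xL; rewrite /l4.
  have u2lx' : u2 n.+1 x @[n --> \oo] --> l2 x by rewrite (cvg_shiftS (fun n => u2 n x)).
  have uI' : int0 L (u n.+1) @[n --> \oo] --> I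
    by rewrite (cvg_shiftS (fun n => int0 L (u n))).
  rewrite (_ : (fun n => f n x) = fun n => p x + (((a + b * int0 L (u n) - M) * u2 n x
    + M * u2 n.+1 x) + (N * int0 L (u n) - c * int0 L (u n) - N * int0 L (u n.+1))));
      last first.
    by apply/funext => n; rewrite fE.
  apply: cvgD; first exact: cvg_cst.
  apply: cvgD.
    apply: cvgD; last exact: cvgMr.
    apply: cvgM => //; apply: cvgB; last exact: cvg_cst.
    by apply: cvgD; [exact: cvg_cst|exact: cvgMr].
  by apply: cvgB; [apply: cvgB; exact: cvgMr|exact: cvgMr].
pose g x := `|p x| + (((`|a| + b * BI + M) * B + M * B) + (N * BI + `|c| * BI + N * BI)).
have gi : mu.-integrable `[0, L] (EFin \o g).
  apply: integrableD_fun => //; first exact: (integrable_norm pi).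
  exact: integrable_cst_itv0.
have fg n : {in `[0, L], forall x, `|f n x| <= g x}.
  move=> x xL; have u2x := uB n x xL; have u2x' := uB n.+1 x xL.
  have I1 := IB n; have I2 := IB n.+1; rewrite fE /g.
  have mulB (r s A T : R) : `|r| <= A -> `|s| <= T -> `|r * s| <= A * T.
    by move=> ? ?; rewrite normrM ler_pM.
  have nM : `|M| <= M by rewrite ger0_norm// ltW.
  have nN : `|N| <= N by rewrite ger0_norm// ltW.
  have nb : `|b| <= b by rewrite ger0_norm// ltW.
  apply: le_trans (ler_normD _ _) _; rewrite lerD2l.
  apply: le_trans (ler_normD _ _) _; apply: lerD.
    apply: le_trans (ler_normD _ _) _; apply: lerD; apply: (mulB) => //.
    apply: le_trans (ler_normB _ _) _; apply: lerD => //.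
    by apply: le_trans (ler_normD _ _) _; apply: lerD => //; exact: (mulB).
  apply: le_trans (ler_normB _ _) _; apply: lerD; last exact: (mulB).
  by apply: le_trans (ler_normB _ _) _; apply: lerD; exact: (mulB).
have bc n : BC L (u n.+1) (u2 n.+1) by case: (it n).
(* The sequences are shifted by one because the starting function satisfies no iteration
   equation. *)
have [y2 [y3 [acy2 acy3 y20 y2L ucv2]]] := dirichlet_dominated L (fun n => u2 n.+1)
  (fun n => u3 n.+1) f g l4 L0 (fun n => let: And4 _ _ h _ := ac n.+1 in h) ac3
  (fun n => (bc n).2.2.1) (fun n => (bc n).2.2.2) f_l4 gi fg.
have l2E : {in `[0, L], l2 =1 y2}.
  move=> x xL; have := unif_cvg_pointwise _ _ _ _ ucv2 xL.
  rewrite (cvg_shiftS (fun n => u2 n x)) => h.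
  exact: (cvg_unique _ (u2l x xL) h).
have u2y2 : {in `[0, L], forall x, u2 n x @[n --> \oo] --> y2 x}.
  by move=> x xL; rewrite -l2E//; exact: u2l.
have u2y2' : {in `[0, L], forall x, u2 n.+1 x @[n --> \oo] --> y2 x}.
  by move=> x xL; rewrite (cvg_shiftS (fun n => u2 n x)); exact: u2y2.
have [y [y1 [acy acy1 y0 yL ucv]]] := dirichlet_dominated L (fun n => u n.+1)
  (fun n => u1 n.+1) (fun n => u2 n.+1) (fun=> B) y2 L0
  (fun n => let: And4 h _ _ _ := ac n.+1 in h)
  (fun n => let: And4 _ h _ _ := ac n.+1 in h)
  (fun n => (bc n).1) (fun n => (bc n).2.1) u2y2' (integrable_cst_itv0 L B)
  (fun n => uB n.+1).
have {}ucv : unif_cvg L u y.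
  move=> e e0; have [n0 Hn] := ucv e e0; exists n0.+1 => -[//|n] nn0 x xL.
  exact: Hn.
have IE : I = int0 L y.
  suff h : int0 L (u n) @[n --> \oo] --> int0 L y by exact: (cvg_unique _ uI h).
  apply/cvgrPdist_lt => e e0.
  have e2 : 0 < e / 2 / L by rewrite !divr_gt0.
  have [n0 Hn] := ucv _ e2; exists n0 => // n /= nn0.
  have ui : mu.-integrable `[0, L] (EFin \o u n).
    by have [+ _ _ _] := ac n; exact: ac_on_integrable.
  have yi : mu.-integrable `[0, L] (EFin \o y) by exact: ac_on_integrable acy.
  have di : mu.-integrable `[0, L] (EFin \o (fun z => u n z + (-1) * y z)).
    by apply: integrableD_fun => //; exact: integrableZ_fun.
  rewrite distrC (_ : _ - _ = int0 L (fun z => u n z + (-1) * y z)); last first.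
    by rewrite (int0D L)// ?(int0Z L)//; [ring|exact: integrableZ_fun].
  apply: (@le_lt_trans _ _ (int0 L (fun=> e / 2 / L))).
    apply: (int0_norm_le L) => //; first exact: integrable_cst_itv0.
    + by move=> z zL; rewrite mulN1r; exact/ltW/Hn.
    + by rewrite in_itv/= L0' lexx.
  by rewrite int0_cst// divfK ?gt_eqF// ltr_pdivrMr// ltr_pMr// ltr1n.
(* The fourth derivative is solved for from the equation, which therefore holds at every point. *)
exists y, y1, y2, y3, (fun x => p x + (a + b * I) * y2 x - c * I); split => //.
split.
- apply/W41_ac_on => //; split => //.
  apply: eq_ac_on acy3 => // x xL; rewrite /l4 l2E//; ring.
- apply: negligibleS (negligible_set0 mu) => x /= [_]; apply.
  by rewrite /Pop -IE; ring.
- by [].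
Qed.

End monotone_iteration.

(** * Monotone sequences from the lower and upper solutions, and their extremal limits *)

Theorem theorem4p1 (R : realType) (L a b c M N : R) (p : R -> R)
  (al al1 al2 al3 al4 be be1 be2 be3 be4 : R -> R)
  (als als1 als2 als3 als4 bes bes1 bes2 bes3 bes4 : nat -> R -> R) :
  0 < L -> 0 < a -> 0 < b -> 0 < c -> 0 < M -> 0 < N ->
  (@lebesgue_measure R).-integrable `[0, L] (EFin \o p) ->
  N <= 4 * M / L ^+ 3 * sigma (Num.sqrt M * L) ->
  is_lowerP L a b c p al al1 al2 al3 al4 ->
  is_upperP L a b c p be be1 be2 be3 be4 ->
  (forall x, x \in `[0, L] ->
     [/\ 0 <= al x, al x <= be x, al2 x <= 0 & be2 x <= al2 x]) ->
  a + b * int0 L be <= M ->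
  (exists2 x0, x0 \in `[0, L] &
     (forall x, x \in `[0, L] -> be2 x0 <= be2 x) /\ c - b * be2 x0 <= N) ->
  (* the iteration sequences starting at alpha and at beta *)
  [/\ als 0%N = al, als1 0%N = al1, als2 0%N = al2, als3 0%N = al3
    & als4 0%N = al4] ->
  [/\ bes 0%N = be, bes1 0%N = be1, bes2 0%N = be2, bes3 0%N = be3
    & bes4 0%N = be4] ->
  (forall n : nat, is_iterP L a b c M N p (als n) (als2 n)
     (als n.+1) (als1 n.+1) (als2 n.+1) (als3 n.+1) (als4 n.+1)) ->
  (forall n : nat, is_iterP L a b c M N p (bes n) (bes2 n)
     (bes n.+1) (bes1 n.+1) (bes2 n.+1) (bes3 n.+1) (bes4 n.+1)) ->
  (* conclusions *)
  (exists y y1 y2 y3 y4,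
     is_solP L a b c p y y1 y2 y3 y4 /\ in_ab L al al2 be be2 y y2) /\
  (forall (n : nat) x, x \in `[0, L] ->
     [/\ als n x <= als n.+1 x, als n x <= bes n x & bes n.+1 x <= bes n x] /\
     [/\ als2 n.+1 x <= als2 n x, bes2 n x <= als2 n x
       & bes2 n x <= bes2 n.+1 x]) /\
  (exists (ylo ylo1 ylo2 ylo3 ylo4 yhi yhi1 yhi2 yhi3 yhi4 : R -> R),
     [/\ is_solP L a b c p ylo ylo1 ylo2 ylo3 ylo4 /\
           in_ab L al al2 be be2 ylo ylo2,
         is_solP L a b c p yhi yhi1 yhi2 yhi3 yhi4 /\
           in_ab L al al2 be be2 yhi yhi2,
         unif_cvg L als ylo /\ unif_cvg L bes yhi &
         forall y y1 y2 y3 y4, is_solP L a b c p y y1 y2 y3 y4 ->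
           in_ab L al al2 be be2 y y2 ->
           forall x, x \in `[0, L] ->
             [/\ ylo x <= y x, y x <= yhi x, y2 x <= ylo2 x & yhi2 x <= y2 x]]).
Proof.
move=> L0 a0 b0 c0 M0 N0 pi NM lowal upbe alle aM [x0 x0L [bemin cNx0]].
move=> [als0 als10 als20 als30 als40] [bes0 bes10 bes20 bes30 bes40] ita itb.
have L0' := ltW L0.
have Wal : W41 L al al1 al2 al3 al4 by case: lowal.
have Wbe : W41 L be be1 be2 be3 be4 by case: upbe.
have bei := W41_integrable L L0 _ _ _ _ _ Wbe.
have Wals n : W41 L (als n) (als1 n) (als2 n) (als3 n) (als4 n).
  case: n => [|n]; last by case: (ita n).
  by rewrite als0 als10 als20 als30 als40.
have Wbes n : W41 L (bes n) (bes1 n) (bes2 n) (bes3 n) (bes4 n).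
  case: n => [|n]; last by case: (itb n).
  by rewrite bes0 bes10 bes20 bes30 bes40.
have alsi n := W41_integrable L L0 _ _ _ _ _ (Wals n).
have besi n := W41_integrable L L0 _ _ _ _ _ (Wbes n).
have cN x : x \in `[0, L] -> c - b * be2 x <= N.
  move=> /bemin bx; apply: le_trans cNx0; rewrite lerD2l lerN2.
  by rewrite ler_pM2l.
have step := fun z z2 w w2 y y1 y2 y3 y4 u u1 u2 u3 u4 zi wi =>
  @ord2_step R L a b c M N p L0 b0 M0 N0 NM z z2 w w2 be be2
    y y1 y2 y3 y4 u u1 u2 u3 u4 zi wi bei aM cN.
have albe : ord2 L al al2 be be2 by move=> x /alle[].
have suba := fun n => iter_sub_step _ _ _ _ _ _ _ _ _ _ _ _ _ _ (ita n).
have supa := fun n => iter_sup_step _ _ _ _ _ _ _ _ _ _ _ _ _ _ (ita n).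
have subb := fun n => iter_sub_step _ _ _ _ _ _ _ _ _ _ _ _ _ _ (itb n).
have supb := fun n => iter_sup_step _ _ _ _ _ _ _ _ _ _ _ _ _ _ (itb n).
have subal := lower_sub_step _ _ _ _ M N _ _ _ _ _ _ lowal.
have supbe := upper_sup_step _ _ _ _ M N _ _ _ _ _ _ upbe.
(* Stated for any upper solution between [al] and [be]: taken at [be] it bounds the sequence, taken
   at a solution it yields minimality of the limit. [bes_ge] plays the dual role. *)
have als_le w w1 w2 w3 w4 : is_upperP L a b c p w w1 w2 w3 w4 ->
    ord2 L al al2 w w2 -> ord2 L w w2 be be2 ->
    forall n, ord2 L (als n) (als2 n) w w2.
  move=> upw alw wbe; have [Ww _ _] := upw.
  have wi := W41_integrable L L0 _ _ _ _ _ Ww.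
  elim=> [|n IH]; first by rewrite als0 als20.
  exact: step (alsi n) wi IH wbe (suba n) (upper_sup_step _ _ _ _ M N _ _ _ _ _ _ upw).
have als_be n : ord2 L (als n) (als2 n) be be2
  by exact: als_le upbe albe (ord2_refl _ _ _) n.
have als_mono n : ord2 L (als n) (als2 n) (als n.+1) (als2 n.+1).
  elim: n => [|n IH]; last first.
    exact: step (alsi n) (alsi n.+1) IH (als_be n.+1) (suba n) (supa n.+1).
  (* The first comparison sets [al], a sub-step from itself, against the first iterate, a step from
     [al]. *)
  have sub0 := subal; rewrite -als0 -als10 -als20 -als30 -als40 in sub0.
  exact: step (alsi 0%N) (alsi 0%N) (ord2_refl _ _ _) (als_be 0%N) sub0 (supa 0%N).
(* The two facts need each other: the comparison step requires its functions to lie below [be], and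
   staying below [be] comes from the decrease. *)
have bes_be_mono n : ord2 L (bes n) (bes2 n) be be2 /\
    ord2 L (bes n.+1) (bes2 n.+1) (bes n) (bes2 n).
  elim: n => [|n [IHbe IH]].
    have e : ord2 L (bes 0%N) (bes2 0%N) be be2 by rewrite bes0 bes20.
    split=> //.
    have sup0 := supbe; rewrite -bes0 -bes10 -bes20 -bes30 -bes40 in sup0.
    exact: step (besi 0%N) (besi 0%N) (ord2_refl _ _ _) e (subb 0%N) sup0.
  split; first exact: ord2_trans IH IHbe.
  exact: step (besi n.+1) (besi n) IH IHbe (subb n.+1) (supb n).
have bes_be n := (bes_be_mono n).1.
have bes_mono n := (bes_be_mono n).2.
have bes_ge w w1 w2 w3 w4 : is_lowerP L a b c p w w1 w2 w3 w4 ->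
    ord2 L w w2 be be2 -> forall n, ord2 L w w2 (bes n) (bes2 n).
  move=> loww wbe; have [Ww _ _] := loww.
  have wi := W41_integrable L L0 _ _ _ _ _ Ww.
  elim=> [|n IH]; first by rewrite bes0 bes20.
  exact: step wi (besi n) IH (bes_be n)
    (lower_sub_step _ _ _ _ M N _ _ _ _ _ _ loww) (supb n).
have als_bes n : ord2 L (als n) (als2 n) (bes n) (bes2 n).
  elim: n => [|n IH]; first by rewrite als0 als20 bes0 bes20.
  exact: step (alsi n) (besi n) IH (bes_be n) (suba n) (supb n).
have al_als n : ord2 L al al2 (als n) (als2 n).
  elim: n => [|n IH]; first by rewrite als0 als20.
  exact: ord2_trans IH (als_mono n).
have al_bes n : ord2 L al al2 (bes n) (bes2 n) by exact: bes_ge lowal albe n.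
(* Here [z2] lies between the minimum [be2 x0] and [al2 <= 0]; this gives the constant dominating
   all second derivatives. *)
have bound z z2 : ord2 L al al2 z z2 -> ord2 L z z2 be be2 ->
    {in `[0, L], forall x, `|z2 x| <= - be2 x0}.
  move=> alz zbe x xL; have [_ ?] := alz x xL; have [_ ?] := zbe x xL.
  have [_ _ ? _] := alle x xL; have ? := bemin x xL.
  by rewrite ler0_norm; lra.
have als2_cvg x : x \in `[0, L] -> cvgn (fun n => als2 n x).
  move=> xL; apply: nonincreasing_is_cvgn.
    by apply/nonincreasing_seqP => n; have [] := als_mono n x xL.
  by exists (be2 x) => _ [n _ <-]; have [] := als_be n x xL.
have bes2_cvg x : x \in `[0, L] -> cvgn (fun n => bes2 n x).
  move=> xL; apply: nondecreasing_is_cvgn.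
    by apply/nondecreasing_seqP => n; have [] := bes_mono n x xL.
  by exists (al2 x) => _ [n _ <-]; have [] := al_bes n x xL.
have alsI : cvgn (fun n => int0 L (als n)).
  apply: nondecreasing_is_cvgn.
    by apply/nondecreasing_seqP => n /=; apply: (le_int0 L) => // x /(als_mono n)[].
  by exists (int0 L be) => _ [n _ <-] /=; apply: (le_int0 L) => // x /(als_be n)[].
have besI : cvgn (fun n => int0 L (bes n)).
  apply: nonincreasing_is_cvgn.
    by apply/nonincreasing_seqP => n /=; apply: (le_int0 L) => // x /(bes_mono n)[].
  have ali := W41_integrable L L0 _ _ _ _ _ Wal.
  by exists (int0 L al) => _ [n _ <-] /=; apply: (le_int0 L) => // x /(al_bes n)[].
have [ylo [ylo1 [ylo2 [ylo3 [ylo4 [sollo cvlo cvlo2]]]]]] :=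
  @iter_limit R L a b c M N p L0 b0 M0 N0 pi als als1 als2 als3 als4 (- be2 x0) _
    (fun x => limn (fun n => als2 n x)) ita (Wals 0%N)
    (fun n => bound _ _ (al_als n) (als_be n)) als2_cvg alsI.
have [yhi [yhi1 [yhi2 [yhi3 [yhi4 [solhi cvhi cvhi2]]]]]] :=
  @iter_limit R L a b c M N p L0 b0 M0 N0 pi bes bes1 bes2 bes3 bes4 (- be2 x0) _
    (fun x => limn (fun n => bes2 n x)) itb (Wbes 0%N)
    (fun n => bound _ _ (al_bes n) (bes_be n)) bes2_cvg besI.
have lim_le (z z2 : nat -> R -> R) (l l2 w w2 : R -> R) : unif_cvg L z l ->
    {in `[0, L], forall x, z2 n x @[n --> \oo] --> l2 x} ->
    (forall n, ord2 L (z n) (z2 n) w w2) -> ord2 L l l2 w w2.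
  move=> zl z2l zw x xL; split.
    apply: (cvgr_to_le (unif_cvg_pointwise _ _ _ _ zl xL)).
    by apply: nearW => n; have [] := zw n x xL.
  apply: (cvgr_to_ge (z2l x xL)).
  by apply: nearW => n; have [] := zw n x xL.
have lim_ge (z z2 : nat -> R -> R) (l l2 w w2 : R -> R) : unif_cvg L z l ->
    {in `[0, L], forall x, z2 n x @[n --> \oo] --> l2 x} ->
    (forall n, ord2 L w w2 (z n) (z2 n)) -> ord2 L w w2 l l2.
  move=> zl z2l zw x xL; split.
    apply: (cvgr_to_ge (unif_cvg_pointwise _ _ _ _ zl xL)).
    by apply: nearW => n; have [] := zw n x xL.
  apply: (cvgr_to_le (z2l x xL)).
  by apply: nearW => n; have [] := zw n x xL.
have ablo : in_ab L al al2 be be2 ylo ylo2.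
  move=> x xL; have [] := lim_le _ _ _ _ _ _ cvlo cvlo2 als_be x xL.
  by have [] := lim_ge _ _ _ _ _ _ cvlo cvlo2 al_als x xL; split.
have abhi : in_ab L al al2 be be2 yhi yhi2.
  move=> x xL; have [] := lim_le _ _ _ _ _ _ cvhi cvhi2 bes_be x xL.
  by have [] := lim_ge _ _ _ _ _ _ cvhi cvhi2 al_bes x xL; split.
split; first by exists ylo, ylo1, ylo2, ylo3, ylo4.
split.
  move=> n x xL; have [? ?] := als_mono n x xL; have [? ?] := als_bes n x xL.
  by have [? ?] := bes_mono n x xL.
exists ylo, ylo1, ylo2, ylo3, ylo4, yhi, yhi1, yhi2, yhi3, yhi4; split=> //.
move=> y y1 y2 y3 y4 soly aby.
have aly : ord2 L al al2 y y2 by move=> x /aby[].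
have ybe : ord2 L y y2 be be2 by move=> x /aby[].
(* A solution is both an upper and a lower solution, so it stays above every [als n] and below every
   [bes n], hence between the limits. *)
have lo := lim_le _ _ _ _ _ _ cvlo cvlo2
  (als_le _ _ _ _ _ (sol_upper _ _ _ _ _ _ _ _ _ _ soly) aly ybe).
have hi := lim_ge _ _ _ _ _ _ cvhi cvhi2
  (bes_ge _ _ _ _ _ (sol_lower _ _ _ _ _ _ _ _ _ _ soly) ybe).
by move=> x xL; have [? ?] := lo x xL; have [? ?] := hi x xL.
Qed.
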